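(* Let $0<\theta<1$ and consider the discrete-time duplication–deletion random graph with parameter $\theta$. Let $N_n$ denote the number of vertices and $M_n$ the maximal degree of the graph after $n$ steps. Let $\gamma=\frac{1-\theta}{\theta}$ and, for $\theta\neq 1/2$, $\beta=\frac{\theta}{2\theta-1}$. Then the following hold almost surely. Subcritical case: if $0<\theta<1/2$, then $$\frac{1-\theta}{\log\gamma}\le\liminf_{n\to\infty}\frac{M_n}{\log N_n}\le\limsup_{n\to\infty}\frac{M_n}{\log N_n}\le\frac{1+\theta}{\theta\log\gamma}.$$ Critical case: if $\theta=1/2$, then $$\frac{1}{16}\le\liminf_{n\to\infty}\frac{M_n}{\log^2N_n}\le\limsup_{n\to\infty}\frac{M_n}{\log^2 N_n}\le\frac{9}{4}.$$ Supercritical case: if $1/2<\theta<1$, then $$\frac{\theta}{\beta}\le\liminf_{n\to\infty}\frac{\log M_n}{\log N_n}\le\limsup_{n\to\infty}\frac{\log M_n}{\log N_n}\le\frac{1}{\beta}.$$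
   Context: Discrete-time duplication–deletion graph with parameter $0<\theta<1$: start from a single vertex without edges. At each step a vertex $v$ is selected uniformly at random among the existing vertices. Independently of the past (and of the choice of $v$), with probability $\theta$ the vertex $v$ is duplicated: a new vertex is added and connected by single edges to $v$ and to all neighbours of $v$. Otherwise, with probability $1-\theta$, $v$ is deleted, meaning that all edges of $v$ are deleted, but the vertex $v$ itself stays in the graph (and may get new edges later). Here $\log^2 x=(\log x)^2$. *)

(* Defs.v *)
From HB Require Import structures.
From mathcomp Require Import all_boot all_order all_algebra.
From mathcomp Require Import all_classical all_reals all_analysis.

Set Implicit Arguments.
Unset Strict Implicit.
Unset Printing Implicit Defensive.

Import Order.TTheory GRing.Theory Num.Theory.
Import numFieldNormedType.Exports.

Local Open Scope classical_set_scope.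
Local Open Scope ring_scope.

(* Vertices are numbered by order of arrival. *)
Record graph := Graph { order : nat; edge : rel 'I_order }.
Arguments edge : clear implicits.

Definition degree (g : graph) (x : 'I_(order g)) : nat :=
  #|[pred y | edge g x y]|.

Definition max_degree (g : graph) : nat := (\max_(x < order g) degree x)%N.

Definition one_vertex : graph := @Graph 1 (fun _ _ => false).

(* The new vertex is [ord_max], i.e. the one on which [unlift ord_max] is
   [None]; the old vertices keep their numbers. *)
Definition duplicate (g : graph) (v : 'I_(order g)) : graph :=
  @Graph (order g).+1 (fun x y =>
    match unlift ord_max x, unlift ord_max y with
    | Some x', Some y' => edge g x' y'
    | Some z, None | None, Some z => (z == v) || edge g v z
    | None, None => false
    end).
Arguments duplicate : clear implicits.

Definition delete (g : graph) (v : 'I_(order g)) : graph :=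
  @Graph (order g) (fun x y => [&& edge g x y, x != v & y != v]).
Arguments delete : clear implicits.

(* [b = true] means duplication. A number [v] which is not a vertex of [g]
   leaves [g] unchanged; under [duplication_deletion] below this happens with
   probability 0. *)
Definition step (g : graph) (v : nat) (b : bool) : graph :=
  if (insub v : option 'I_(order g)) is Some v' then
    (if b then duplicate g v' else delete g v')
  else g.

(* The graph after [n] steps; only [v i] and [b i] for [i < n] matter. *)
Fixpoint dd_graph (v : nat -> nat) (b : nat -> bool) (n : nat) : graph :=
  if n is m.+1 then step (dd_graph v b m) (v m) (b m) else one_vertex.

Section Process.
Context (R : realType) (d : measure_display) (T : measurableType d)
        (P : probability T R).
Variables (theta : R) (V : nat -> {RV P >-> nat}) (B : nat -> {RV P >-> bool}).

Definition history (v : nat -> nat) (b : nat -> bool) (n : nat) : set T :=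
  [set w | forall i, (i < n)%N -> V i w = v i /\ B i w = b i].

(* [V n] and [B n] are the vertex and the type of the (n+1)-st step. Given any
   past, they are independent, [V n] is uniform on the vertices of the current
   graph and [B n] is Bernoulli(theta). The processes being discrete, it is
   enough to say so for each possible finite history, and the product form
   avoids conditioning on null events. *)
Definition duplication_deletion : Prop :=
  forall (v : nat -> nat) (b : nat -> bool) (n : nat),
    let N := order (dd_graph v b n) in
    P (history v b n.+1) =
    (P (history v b n) *
     ((if (v n < N)%N then N%:R^-1 else 0) *
      (if b n then theta else 1 - theta))%:E)%E.

Definition graph_after (n : nat) (w : T) : graph :=
  dd_graph (fun i => V i w) (fun i => B i w) n.

Definition nb_vertices (n : nat) (w : T) : nat := order (graph_after n w).

Definition maximal_degree (n : nat) (w : T) : nat :=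
  max_degree (graph_after n w).

End Process.

Definition dd_gamma (R : realType) (theta : R) : R := (1 - theta) / theta.

Definition dd_beta (R : realType) (theta : R) : R := theta / (2 * theta - 1).

(* Main.v *)
(* The graph is always a disjoint union of cliques: duplicating a vertex enlarges
   its clique by one, deleting it shrinks the clique by one and creates a clique
   of size 1. So the cliques form a branching process, [M_n + 1] is the largest
   clique size, and for any [f] with [f 0 = 0] the sum [S_f] of [f] over the
   clique sizes has an explicit drift. Everything follows from nonnegative
   supermartingales and Ville's inequality, with the number of vertices [N] as
   clock.

   Upper bounds: [S_f / N^q + A / N] is a supermartingale for large [N], hence
   [f (M_n + 1) <= S_f <= K N^q]; take [f k = gamma^k] in the subcritical case,
   [f k = exp (3/2 sqrt k)] in the critical one, and polynomials of large degree
   in the supercritical one.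

   Supercritical lower bound: for a polynomial [f] of large degree [p], no single
   step changes [S_f] by more than a small fraction, so [N^q / S_f] is a
   supermartingale when [q < p / beta].

   Subcritical and critical lower bounds: let [U_s] count the vertices in cliques
   of size [s]. If [c] is a strict subsolution of the stationary equation of
   [U_s / N], the barriers [U_s >= N c_s / N0 - A log^7 N] are kept forever,
   simultaneously in [s], from the moment when there are [N0] vertices, except
   with a probability that tends to 0 as [N0] grows: at that moment all of them
   are negative, and as long as none is broken each
   [exp (eta_s (barrier - U_s))] is a supermartingale up to an error [N^-6].
   Hence a clique of size [s] exists as soon as [N c_s] exceeds [log^7 N] by a
   large factor; take [c_s = gamma^-s s^-p] and [c_s = exp (-3 sqrt s)]. *)

Require Import Defs.
From mathcomp Require Import all_boot all_order all_algebra.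
From mathcomp Require Import all_classical all_reals all_analysis.
From mathcomp Require Import ring lra zify.
(* Imported again so that [order] is not the one of [fingraph]. *)
Require Import Defs.

Set Implicit Arguments.
Unset Strict Implicit.
Unset Printing Implicit Defensive.

Import Order.TTheory GRing.Theory Num.Theory.
Import numFieldNormedType.Exports.

Local Open Scope classical_set_scope.
Local Open Scope ring_scope.

(** * Disjoint unions of cliques *)

(** The case [x = z] is excluded because [edge] is irreflexive; the equivalence relation is
    [same_clique], adjacency or equality. *)
Definition clique_graph (g : graph) :=
  [/\ irreflexive (edge g), symmetric (edge g) &
      forall x y z, edge g x y -> edge g y z -> x != z -> edge g x z].

Definition same_clique (g : graph) (x y : 'I_(order g)) :=
  (x == y) || edge g x y.
Arguments same_clique : clear implicits.

Definition clique_size (g : graph) (x : 'I_(order g)) := (degree x).+1.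
Arguments clique_size : clear implicits.

Lemma same_clique_sym g : clique_graph g -> symmetric (same_clique g).
Proof. by case=> _ sg _ x y; rewrite /same_clique eq_sym sg. Qed.

Lemma same_clique_trans g : clique_graph g -> transitive (same_clique g).
Proof.
case=> _ sg tg y x z; rewrite /same_clique.
case: (eqVneq x y) => [->//|_] /= exy.
case: (eqVneq y z) => [<-|_] /= eyz; first by rewrite exy orbT.
by case: (eqVneq x z) => //= /(tg _ _ _ exy eyz).
Qed.

Lemma degreeE (g : graph) (x : 'I_(order g)) :
  degree x = (\sum_(y < order g) edge g x y)%N.
Proof. by rewrite /degree -sum1_card big_mkcond. Qed.

Lemma clique_sizeE g x : clique_graph g ->
  clique_size g x = (\sum_(y < order g) same_clique g x y)%N.
Proof.
case=> ig _ _; rewrite /clique_size degreeE (bigD1 x)//= ig add0n.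
rewrite [RHS](bigD1 x)//= /same_clique eqxx /= add1n; congr _.+1.
by apply: eq_bigr => y yx; rewrite [x == y]eq_sym (negbTE yx).
Qed.

Lemma eq_clique_size g x y : clique_graph g -> same_clique g x y ->
  clique_size g x = clique_size g y.
Proof.
move=> cg xy; rewrite !clique_sizeE//; apply: eq_bigr => z _; congr nat_of_bool.
apply/idP/idP; last exact: same_clique_trans.
by apply: same_clique_trans => //; rewrite same_clique_sym.
Qed.

Lemma clique_size_gt0 g x : (0 < clique_size g x)%N.
Proof. by []. Qed.

Lemma clique_size_le g x : clique_graph g -> (clique_size g x <= order g)%N.
Proof.
move=> cg; rewrite clique_sizeE// -[leqRHS]card_ord -sum1_card.
by apply: leq_sum => y _; case: same_clique.
Qed.

Lemma clique_graph_one_vertex : clique_graph one_vertex.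
Proof. by split. Qed.

(** The new vertex is a twin of [v]: it is joined to exactly the clique of [v], so every case
    reduces to symmetry and transitivity of [same_clique]. *)
Lemma clique_graph_duplicate g v : clique_graph g ->
  clique_graph (duplicate g v).
Proof.
move=> cg; case: (cg) => ig sg tg.
have scs := same_clique_sym cg; have sct := same_clique_trans cg.
have E z : (z == v) || edge g v z = same_clique g v z.
  by rewrite /same_clique eq_sym.
split=> [x|x y|x y z] /=.
- by case: unliftP => [x' _|_]; rewrite ?ig.
- by case: unliftP => [x' _|_]; case: unliftP => [y' _|_].
- case: (unliftP ord_max x) => [x' ->|->];
    case: (unliftP ord_max y) => [y' _|_];
    case: (unliftP ord_max z) => [z' ->|->] //=;
    rewrite ?E ?(inj_eq lift_inj) ?eqxx//.
  + exact: tg.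
  + move=> xy vy _; apply: sct vy _; rewrite scs /same_clique xy orbT//.
  + move=> vx vz xz; have : same_clique g x' z' by apply: sct vz; rewrite scs.
    by rewrite /same_clique (negbTE xz).
  + by move=> vy yz _; apply: sct vy _; rewrite /same_clique yz orbT.
Qed.

Lemma clique_graph_delete g v : clique_graph g -> clique_graph (delete g v).
Proof.
case=> ig sg tg; split=> [x|x y|x y z] /=; first by rewrite ig.
  by rewrite sg [(y != v) && _]andbC.
by move=> /and3P[xy xv yv] /and3P[yz _ zv] xz; rewrite (tg _ y) ?xv ?zv.
Qed.

Lemma clique_size_duplicate_old g v x : clique_graph g ->
  clique_size (duplicate g v) (lift ord_max x) =
  (clique_size g x + same_clique g v x)%N.
Proof.
move=> cg; rewrite /clique_size !degreeE /= big_ord_recr /= addSn.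
congr (_.+1); rewrite liftK unlift_none /same_clique eq_sym; congr addn.
apply: eq_bigr => y _.
have -> : widen_ord (leqnSn (order g)) y = lift ord_max y.
  by apply: val_inj; rewrite /= /bump leqNgt ltn_ord.
by rewrite liftK.
Qed.

Lemma clique_size_duplicate_new g v : clique_graph g ->
  clique_size (duplicate g v) ord_max = (clique_size g v).+1.
Proof.
move=> cg; rewrite (clique_sizeE _ cg).
rewrite /clique_size degreeE /= big_ord_recr /= unlift_none addn0.
congr (_.+1); apply: eq_bigr => y _.
have -> : widen_ord (leqnSn (order g)) y = lift ord_max y.
  by apply: val_inj; rewrite /= /bump leqNgt ltn_ord.
by rewrite liftK /same_clique eq_sym.
Qed.

Lemma clique_size_delete_self g v : clique_size (delete g v) v = 1%N.
Proof.
rewrite /clique_size degreeE /= big1// => y _.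
by rewrite eqxx andbF.
Qed.

Lemma clique_size_delete g v x : clique_graph g -> x != v ->
  (clique_size (delete g v) x + same_clique g v x)%N = clique_size g x.
Proof.
move=> [ig sg _] xv; rewrite /clique_size !degreeE /= addSn; congr _.+1.
rewrite /same_clique [v == x]eq_sym (negbTE xv) /= [edge g v x]sg.
rewrite (bigD1 v)//= [RHS](bigD1 v)//= eqxx !andbF add0n addnC; congr addn.
by apply: eq_bigr => y yv; rewrite yv /= andbT.
Qed.

(** * Sums over the cliques and their change in one step *)

Section CliqueSum.
Variable R : realType.
Implicit Types (f : nat -> R) (g : graph).

(* Since a clique of size [k] has [k] vertices, this is the sum of [f k] over
   the cliques. *)
Definition clique_sum f g : R :=
  \sum_(x < order g) f (clique_size g x) / (clique_size g x)%:R.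

Lemma sum_same_clique (h : nat -> R) g (v : 'I_(order g)) : clique_graph g ->
  \sum_(x < order g | same_clique g v x) h (clique_size g x) =
  (clique_size g v)%:R * h (clique_size g v).
Proof.
move=> cg; under eq_bigr => x vx do rewrite -(eq_clique_size cg vx).
rewrite sumr_const mulr_natl; congr (_ *+ _).
by rewrite [RHS]clique_sizeE// -sum1_card big_mkcond.
Qed.

(** Only the clique of [v] changes: [k] vertices of weight [f k / k] become [k + 1] vertices of
    weight [f k.+1 / k.+1]. *)
Lemma clique_sum_duplicate f g v : clique_graph g ->
  clique_sum f (duplicate g v) =
  clique_sum f g + f (clique_size g v).+1 - f (clique_size g v).
Proof.
move=> cg; set k := clique_size g v.
have k0 : k%:R != 0 :> R by rewrite pnatr_eq0.
have k1 : k.+1%:R != 0 :> R by rewrite pnatr_eq0.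
rewrite /clique_sum /= big_ord_recr /= clique_size_duplicate_new// -/k.
under eq_bigr => x _.
  have -> : widen_ord (leqnSn (order g)) x = lift ord_max x.
    by apply: val_inj; rewrite /= /bump leqNgt ltn_ord.
  rewrite clique_size_duplicate_old//; over.
rewrite (bigID (same_clique g v)) [in RHS](bigID (same_clique g v)) /=.
under eq_bigr => x vx do rewrite vx.
under [X in _ + X + _]eq_bigr => x /negbTE -> do rewrite addn0.
rewrite (@sum_same_clique (fun n => f (n + 1)%N / (n + 1)%:R))//.
rewrite (@sum_same_clique (fun n => f n / n%:R))// -/k addn1.
rewrite [k%:R * (f k / _)]mulrCA divff// mulr1.
rewrite [k.+1%:R in LHS](_ : _ = k%:R + 1) -?natr1//.
by rewrite -natr1 in k1; field.
Qed.

(** The hypothesis [f 0 = 0] covers the deletion of an isolated vertex, which leaves an empty clique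
    behind. *)
Lemma clique_sum_delete f g v : clique_graph g -> f 0%N = 0 ->
  clique_sum f (delete g v) =
  clique_sum f g + f (clique_size g v).-1 - f (clique_size g v) + f 1%N.
Proof.
move=> cg f0; set k := clique_size g v.
have k0 : k%:R != 0 :> R by rewrite pnatr_eq0.
rewrite /clique_sum /=.
rewrite (bigID (same_clique g v)) [in RHS](bigID (same_clique g v)) /=.
rewrite (@sum_same_clique (fun n => f n / n%:R))// -/k.
rewrite [k%:R * (f k / _)]mulrCA divff// mulr1.
have -> : \sum_(i < order g | ~~ same_clique g v i)
    f (clique_size (delete g v) i) / (clique_size (delete g v) i)%:R =
  \sum_(i < order g | ~~ same_clique g v i)
    f (clique_size g i) / (clique_size g i)%:R.
  apply: eq_bigr => x vx.
  have xv : x != v by apply: contraNneq vx => ->; rewrite /same_clique eqxx.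
  by rewrite -(clique_size_delete cg xv) (negbTE vx) addn0.
suff -> : \sum_(i < order g | same_clique g v i)
    f (clique_size (delete g v) i) / (clique_size (delete g v) i)%:R =
  f k.-1 + f 1%N by ring.
rewrite (bigD1 v) /=; last by rewrite /same_clique eqxx.
rewrite clique_size_delete_self divr1 addrC; congr (_ + _).
have vv : same_clique g v v by rewrite /same_clique eqxx.
(* A fictitious term for [v] completes the sum to the whole clique, where [sum_same_clique] applies;
   it is subtracted again afterwards. *)
have H : f k.-1 / k.-1%:R + \sum_(x < order g | same_clique g v x && (x != v))
    f (clique_size g x).-1 / (clique_size g x).-1%:R =
  k%:R * (f k.-1 / k.-1%:R).
  by rewrite -(@sum_same_clique (fun n => f n.-1 / n.-1%:R))// [RHS](bigD1 v).
transitivity (k.-1%:R * (f k.-1 / k.-1%:R)).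
  have km1 : k.-1%:R = k%:R - 1 :> R.
    by rewrite /k /clique_size /= -[in RHS]natr1 addrK.
  rewrite [X in _ = X * _]km1.
  rewrite mulrBl mul1r -H addrAC subrr add0r.
  apply: eq_bigr => x /andP[vx xv].
  by rewrite -(clique_size_delete cg xv) vx addn1.
rewrite -[degree v]/(k.-1); have [->|j0] := eqVneq k.-1 0%N; first by rewrite f0 mul0r.
by rewrite mulrCA divff ?mulr1 ?pnatr_eq0 ?pnatr_eq0.
Qed.

Lemma clique_sum_ge f g x : clique_graph g -> (forall s, 0 <= f s) ->
  f (clique_size g x) <= clique_sum f g.
Proof.
move=> cg f0; rewrite /clique_sum (bigID (same_clique g x)) /=.
rewrite (@sum_same_clique (fun n => f n / n%:R))// mulrCA divff ?pnatr_eq0//.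
rewrite mulr1 lerDl; apply: sumr_ge0 => y _.
by rewrite divr_ge0.
Qed.

Lemma clique_sum_le f g b : (forall x, f (clique_size g x) <= b) -> 0 <= b ->
  clique_sum f g <= (order g)%:R * b.
Proof.
move=> fb b0; rewrite /clique_sum mulr_natl -[X in _ *+ X]card_ord -sumr_const.
apply: ler_sum => x _; rewrite ler_pdivrMr ?ltr0n//.
by rewrite (le_trans (fb x))// ler_peMr// ler1n.
Qed.

Lemma clique_sum_ge0 f g : (forall s, 0 <= f s) -> 0 <= clique_sum f g.
Proof. by move=> f0; apply: sumr_ge0 => x _; rewrite divr_ge0. Qed.

(** The transition operator of the Markov chain of graphs. *)
Definition mean_step (theta : R) (F : graph -> R) (g : graph) : R :=
  (order g)%:R^-1 * \sum_(v < order g)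
    (theta * F (duplicate g v) + (1 - theta) * F (delete g v)).

End CliqueSum.

Lemma clique_size_le_max g x : (clique_size g x <= (max_degree g).+1)%N.
Proof. by rewrite ltnS /max_degree; apply: leq_bigmax. Qed.

Lemma max_degree_attained g : (0 < order g)%N ->
  exists x, clique_size g x = (max_degree g).+1.
Proof.
move=> g0; have [|x xP] := @bigop.eq_bigmax _ (@degree g).
  by rewrite card_ord.
by exists x; rewrite /clique_size -xP.
Qed.

(** * The law of the process and Ville's inequality *)

(** Histories are finite sequences, hence elements of a countable type. *)
Definition path_graph (h : seq (nat * bool)) : graph :=
  foldl (fun g x => step g x.1 x.2) one_vertex h.

Lemma path_graph_rcons h x :
  path_graph (rcons h x) = step (path_graph h) x.1 x.2.
Proof. by rewrite /path_graph foldl_rcons. Qed.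

Lemma dd_graphE v b n :
  dd_graph v b n = path_graph (mkseq (fun i => (v i, b i)) n).
Proof. by elim: n => //= n ->; rewrite mkseqS path_graph_rcons. Qed.

Definition moves (g : graph) : seq (nat * bool) :=
  [seq (v, b) | v <- iota 0 (order g), b <- [:: true; false]].

Lemma mem_moves g x : (x \in moves g) = (x.1 < order g)%N.
Proof.
apply/allpairsP/idP => [[[v b] [/= + _ ->]]|xg].
  by rewrite mem_iota.
exists x; split; first by rewrite mem_iota.
  by case: x.2; rewrite !inE.
by case: x {xg}.
Qed.

(** Only moves at existing vertices are listed, so the list is finite; by
    [negligible_hist_notin_paths] it carries the whole law. *)
Fixpoint paths (n : nat) : seq (seq (nat * bool)) :=
  if n is m.+1 then
    [seq rcons h x | h <- paths m, x <- moves (path_graph h)]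
  else [:: [::]].

Lemma step_true g (v : 'I_(order g)) : step g v true = duplicate g v.
Proof. by rewrite /step valK. Qed.

Lemma step_false g (v : 'I_(order g)) : step g v false = delete g v.
Proof. by rewrite /step valK. Qed.

Lemma paths_graph n h : h \in paths n ->
  [/\ size h = n, clique_graph (path_graph h) & (0 < order (path_graph h))%N].
Proof.
elim: n h => [h|n IH h] /=; first by rewrite inE => /eqP ->; split.
move=> /allpairsPdep[h' [[v b] [/= /IH [sh' cg g0]]]].
rewrite mem_moves /= => vg ->; rewrite size_rcons sh'; split=> //;
  rewrite path_graph_rcons /= -[v]/(nat_of_ord (Ordinal vg)).
  case: b; rewrite ?step_true ?step_false; first exact: clique_graph_duplicate.
  exact: clique_graph_delete.
by case: b; rewrite ?step_true ?step_false.
Qed.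

Section Process.
Context (R : realType) (d : measure_display) (T : measurableType d)
        (P : probability T R).
Variables (theta : R) (V : nat -> {RV P >-> nat}) (B : nat -> {RV P >-> bool}).
Hypotheses (theta_ge0 : 0 <= theta) (theta_le1 : theta <= 1).
Hypothesis dd : duplication_deletion theta V B.

Let hist (n : nat) (w : T) : seq (nat * bool) :=
  mkseq (fun i => (V i w, B i w)) n.

Lemma graph_after_hist n w : graph_after V B n w = path_graph (hist n w).
Proof. exact: dd_graphE. Qed.

Let hist_set n h := [set w | hist n w = h].

Lemma measurable_history v b n : measurable (history V B v b n).
Proof.
elim: n => [|n IH].
  rewrite (_ : history _ _ _ _ _ = setT)//.
  by apply/seteqP; split=> // w _ i; rewrite ltn0.
have -> : history V B v b n.+1 =
    history V B v b n `&` (V n @^-1` [set v n] `&` B n @^-1` [set b n]).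
  apply/seteqP; split=> w.
    move=> H; split; last by have [] := H n (ltnSn n).
    by move=> i ilt; apply: H; rewrite ltnS ltnW.
  move=> [H [/= Vn Bn]] i; rewrite ltnS leq_eqVlt => /orP[/eqP ->//|].
  exact: H.
by apply: measurableI => //; apply: measurableI; exact: measurable_funPTI.
Qed.

Lemma hist_setE n h : size h = n ->
  hist_set n h = history V B (fun i => (nth (0%N, false) h i).1)
                             (fun i => (nth (0%N, false) h i).2) n.
Proof.
move=> sh; apply/seteqP; split=> w.
  move=> <- i ilt; rewrite /hist; split; rewrite nth_mkseq//.
move=> H; apply: (@eq_from_nth _ (0%N, false)); first by rewrite size_mkseq sh.
rewrite size_mkseq => i ilt; rewrite nth_mkseq//.
by have [-> ->] := H i ilt; rewrite -surjective_pairing.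
Qed.

Lemma measurable_hist_set n h : measurable (hist_set n h).
Proof.
have [sh|sh] := eqVneq (size h) n.
  by rewrite (hist_setE sh); exact: measurable_history.
rewrite (_ : hist_set n h = set0)//; apply/seteqP; split=> // w /= H.
by move: sh; rewrite -H size_mkseq eqxx.
Qed.

(** Any event of this form is a countable union of atoms. *)
Lemma measurable_hist n (A : set (seq (nat * bool))) :
  measurable [set w | A (hist n w)].
Proof.
rewrite (_ : [set w | _] =
    \bigcup_h (if `[< A h >] then hist_set n h else set0)).
  apply: countable_bigcupT_measurable; first exact: countableP.
  by move=> h; case: ifPn => // _; exact: measurable_hist_set.
apply/seteqP; split=> w /=.
  by move=> Aw; exists (hist n w) => //; rewrite asboolT.
by move=> [h _]; case: ifPn => // /asboolP Ah; rewrite /hist_set /= => ->.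
Qed.

Lemma P_hist_rcons n h x : size h = n ->
  P (hist_set n.+1 (rcons h x)) =
  (P (hist_set n h) *
    ((if (x.1 < order (path_graph h))%N then (order (path_graph h))%:R^-1
      else 0) * (if x.2 then theta else 1 - theta))%:E)%E.
Proof.
move=> sh.
rewrite (hist_setE (n := n.+1)) ?size_rcons ?sh// dd dd_graphE.
have -> : mkseq (fun i => ((nth (0%N, false) (rcons h x) i).1,
                           (nth (0%N, false) (rcons h x) i).2)) n = h.
  apply: (@eq_from_nth _ (0%N, false)); first by rewrite size_mkseq sh.
  rewrite size_mkseq => i ilt.
  by rewrite nth_mkseq// -surjective_pairing nth_rcons sh ilt.
rewrite nth_rcons sh ltnn eqxx; congr (P _ * _)%E.
rewrite (hist_setE sh); apply/seteqP; split=> w H i ilt; have := H i ilt;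
  by rewrite nth_rcons sh ilt.
Qed.

(** Such a history has either left [paths] earlier or makes its last move at a nonexistent vertex.
    Each atom of the second kind is null by [P_hist_rcons], and there are countably many. *)
Lemma negligible_hist_notin_paths n :
  P.-negligible [set w | hist n w \notin paths n].
Proof.
elim: n => [|n IH].
  rewrite (_ : [set w | _] = set0); first exact: negligible_set0.
  by apply/seteqP; split=> // w /=; rewrite inE.
pose F (k : nat) : set T :=
  if unpickle k is Some (h, x) then
    if (size h == n) && (x \notin moves (path_graph h))
    then hist_set n.+1 (rcons h x) else set0
  else set0.
apply: (@negligibleS _ _ _ _
    ([set w | hist n w \notin paths n] `|` \bigcup_k F k)).
  move=> w /=; rewrite /hist mkseqS -/(hist n w) => H.
  have [hp|] := boolP (hist n w \in paths n); [right|by left].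
  exists (pickle (hist n w, (V n w, B n w))) => //; rewrite /F pickleK.
  rewrite size_mkseq eqxx ifT /hist_set /=; first by rewrite /hist mkseqS.
  apply: contra H => xm; apply/allpairsPdep.
  by exists (hist n w), (V n w, B n w).
apply: negligibleU => //; apply: negligible_bigcup => k; rewrite /F.
case: unpickle => [[h x]|]; last exact: negligible_set0.
case: ifPn => [/andP[/eqP sh]|_]; last exact: negligible_set0.
rewrite mem_moves => /negbTE xh; apply/negligibleP.
  exact: measurable_hist_set.
by have := P_hist_rcons x sh; rewrite xh mul0r mule0.
Qed.

Let weight h : R := fine (P (hist_set (size h) h)).

Let weight_ge0 h : 0 <= weight h. Proof. exact: fine_ge0. Qed.

Let weight_rcons h v b : (v < order (path_graph h))%N ->
  weight (rcons h (v, b)) = weight h * ((order (path_graph h))%:R^-1 *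
    (if b then theta else 1 - theta)).
Proof.
move=> vh; rewrite /weight size_rcons P_hist_rcons//= vh fineM//.
exact: fin_num_measure (measurable_hist_set _ _).
Qed.

(** A finite sum over the legal histories takes the place of an integral. *)
Definition expectation (n : nat) (F : seq (nat * bool) -> R) : R :=
  \sum_(h <- paths n) weight h * F h.

Lemma le_expectation n F G : (forall h, h \in paths n -> F h <= G h) ->
  expectation n F <= expectation n G.
Proof.
move=> FG; rewrite /expectation !big_seq; apply: ler_sum => h hp.
by rewrite ler_wpM2l// FG.
Qed.

(** The tower property: given the first [n] moves, the last one is averaged as in [mean_step]. *)
Lemma expectationS n F : expectation n.+1 F =
  expectation n (fun h => (order (path_graph h))%:R^-1 *
    \sum_(v < order (path_graph h))
      (theta * F (rcons h (v : nat, true)) +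
       (1 - theta) * F (rcons h (v : nat, false)))).
Proof.
rewrite /expectation /= big_allpairs_dep /=; apply: eq_bigr => h _.
rewrite /moves big_allpairs_dep /=.
have -> : iota 0 (order (path_graph h)) = index_iota 0 (order (path_graph h)).
  by rewrite /index_iota subn0.
rewrite big_mkord mulrA mulr_sumr; apply: eq_bigr => v _.
by rewrite !big_cons big_nil !weight_rcons//; ring.
Qed.

Lemma P_hist_le n (A : pred (seq (nat * bool))) :
  (P [set w | A (hist n w)] <= (expectation n (fun h => (A h)%:R))%:E)%E.
Proof.
have H (s : seq (seq (nat * bool))) : {subset s <= paths n} ->
    (P [set w | A (hist n w) && (hist n w \in s)] <=
     (\sum_(h <- s) weight h * (A h)%:R)%:E)%E.
  elim: s => [_|h s IH sp].
    rewrite big_nil (_ : [set w | _] = set0) ?measure0//.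
    by apply/seteqP; split=> // w /=; rewrite andbF.
  rewrite big_cons EFinD.
  apply: (@le_trans _ _ (P ((if A h then hist_set n h else set0) `|`
      [set w | A (hist n w) && (hist n w \in s)]))).
    apply: le_measure; rewrite ?inE.
    - exact: (measurable_hist n (fun h' => A h' && (h' \in h :: s))).
    - apply: measurableU.
        by case: ifP => // _; exact: measurable_hist_set.
      exact: (measurable_hist n (fun h' => A h' && (h' \in s))).
    move=> w /= /andP[Aw]; rewrite inE => /orP[/eqP wh|ws].
      by left; rewrite -wh Aw.
    by right; rewrite Aw.
  apply: (le_trans (measureU2 _ _ _)).
  - by case: ifP => // _; exact: measurable_hist_set.
  - exact: (measurable_hist n (fun h' => A h' && (h' \in s))).
  apply: leeD; last by apply: IH => x xs; apply: sp; rewrite inE xs orbT.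
  have [sh _ _] := paths_graph (sp h (mem_head _ _)).
  case: ifP => _; last by rewrite measure0 mulr0.
  rewrite mulr1 /weight sh fineK//.
  exact: fin_num_measure (measurable_hist_set _ _).
have mN : measurable [set w | hist n w \notin paths n].
  exact: (measurable_hist n (fun h' => h' \notin paths n)).
have N0 : P [set w | hist n w \notin paths n] = 0.
  by apply/negligibleP => //; exact: negligible_hist_notin_paths.
apply: (@le_trans _ _ (P ([set w | A (hist n w) && (hist n w \in paths n)]
    `|` [set w | hist n w \notin paths n]))).
  apply: le_measure; rewrite ?inE.
  - exact: (measurable_hist n A).
  - apply: measurableU => //.
    exact: (measurable_hist n (fun h' => A h' && (h' \in paths n))).
  by move=> w /= Aw; case: (boolP (_ \in _)) => wp; [left|right]; rewrite ?Aw.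
apply: (le_trans (measureU2 _ _ _)).
- exact: (measurable_hist n (fun h' => A h' && (h' \in paths n))).
- exact: mN.
by rewrite [X in (_ + X)%E]N0 adde0; exact: H.
Qed.

(* The process is stopped when it leaves [F < 1], so that the supermartingale
   property is needed there only. *)
Lemma ville (F : nat -> graph -> R) : (forall n g, 0 <= F n g) ->
  (forall n g, clique_graph g -> (0 < order g)%N -> F n g < 1 ->
    mean_step theta (F n.+1) g <= F n g) ->
  (P [set w | exists n, (1 <= F n (graph_after V B n w))%R]
    <= (F 0%N one_vertex)%:E)%E.
Proof.
move=> F0 Fstep.
(* [hit] tells whether [F] has reached 1 so far; [H] is the process frozen at 1 from that moment on,
   and its expectation never increases. *)
pose hit h := has (fun k => 1 <= F k (path_graph (take k h)))
  (iota 0 (size h).+1).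
pose H h : R := if hit h then 1 else F (size h) (path_graph h).
have hit_rcons h x : hit (rcons h x) =
    hit h || (1 <= F (size h).+1 (path_graph (rcons h x))).
  rewrite /hit size_rcons -[(size h).+2]addn1 iotaD has_cat [has _ [:: _]]/= orbF.
  rewrite add0n; congr orb.
    apply: eq_in_has => k; rewrite mem_iota add0n ltnS => /andP[_ ks].
    by rewrite -cats1 takel_cat.
  by rewrite take_oversize ?size_rcons.
have EH n : expectation n H <= F 0%N one_vertex.
  elim: n => [|n]; last apply: le_trans.
    rewrite /expectation big_seq1 /H /hit /= orbF /weight.
    rewrite (_ : hist_set _ _ = setT) ?probability_setT /= ?mul1r.
      by case: ifP => //.
    by apply/seteqP; split.
  rewrite expectationS; apply: le_expectation => h /paths_graph[sh cg g0].
  have n0 : (order (path_graph h))%:R != 0 :> R by rewrite pnatr_eq0 -lt0n.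
  rewrite {3}/H; case: ifPn => hh.
    under eq_bigr => v _.
      rewrite /H !hit_rcons hh /= !mulr1 addrC subrK; over.
    by rewrite sumr_const card_ord -mulr_natl mulr1 mulVf.
  have Fh : F (size h) (path_graph h) < 1.
    rewrite ltNge; apply: contra hh => hh; apply/hasP; exists (size h).
      by rewrite mem_iota /= add0n ltnSn.
    by rewrite take_size.
  apply: le_trans (Fstep _ _ cg g0 Fh); rewrite /mean_step.
  rewrite ler_wpM2l ?invr_ge0//; apply: ler_sum => v _.
  have HF x : H (rcons h x) <= F (size h).+1 (path_graph (rcons h x)).
    rewrite /H hit_rcons (negbTE hh) /= size_rcons.
    by case: ifP.
  by apply: lerD; rewrite ler_wpM2l ?subr_ge0//; apply: le_trans (HF _) _;
    rewrite path_graph_rcons ?step_true ?step_false.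
have hitP n w : hit (hist n w) ->
    exists k, 1 <= F k (graph_after V B k w).
  move=> /hasP[k]; rewrite mem_iota add0n size_mkseq ltnS => /= kn.
  by rewrite /hist /mkseq -map_take take_iota (minn_idPl kn); exists k;
    rewrite graph_after_hist.
(* The events [hit] increase with [n], so continuity from below carries the uniform bound over to
   their union. *)
have -> : [set w | exists n, 1 <= F n (graph_after V B n w)] =
    \bigcup_n [set w | hit (hist n w)].
  apply/seteqP; split=> w /=.
    move=> [n Fn]; exists n => //=; apply/hasP; exists n.
      by rewrite mem_iota size_mkseq /= add0n ltnSn.
    by rewrite take_oversize ?size_mkseq// -graph_after_hist.
  by move=> [n _ /hitP].
have hit_cvg : P [set w | hit (hist n w)] @[n --> \oo] -->
    P (\bigcup_n [set w | hit (hist n w)]).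
  apply: (@nondecreasing_cvg_mu _ _ _ P (fun n => [set w | hit (hist n w)])).
  - by move=> n; exact: (measurable_hist n hit).
  - by apply: bigcup_measurable => n _; exact: (measurable_hist n hit).
  - apply/nondecreasing_seqP => n; apply/subsetPset => w /=.
    by rewrite /hist mkseqS hit_rcons => ->.
rewrite -(cvg_lim _ hit_cvg)//; apply: lime_le.
  by apply/cvg_ex; exists (P (\bigcup_n [set w | hit (hist n w)])).
apply: nearW => n /=; apply: (le_trans (P_hist_le n hit)); rewrite lee_fin.
apply: le_trans (EH n); apply: le_expectation => h _; rewrite /H.
by case: (hit h).
Qed.

Lemma measurable_ex_graph (A : nat -> graph -> Prop) :
  measurable [set w | exists n, A n (graph_after V B n w)].
Proof.
rewrite (_ : [set w | _] = \bigcup_n [set w | A n (path_graph (hist n w))]).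
  apply: bigcup_measurable => n _.
  exact: (measurable_hist n (fun h => A n (path_graph h))).
by apply/seteqP; split=> w /= [n]; rewrite ?graph_after_hist => *;
  exists n; rewrite ?graph_after_hist.
Qed.

(** By [ville] for [F / (k + 1)], the level [k + 1] is reached with probability at most the initial
    value over [k + 1]; an unbounded path reaches every level. *)
Lemma supermartingale_bounded (F : nat -> graph -> R) :
  (forall n g, 0 <= F n g) ->
  (forall n g, clique_graph g -> (0 < order g)%N ->
    mean_step theta (F n.+1) g <= F n g) ->
  {ae P, forall w, exists K : R, forall n, F n (graph_after V B n w) <= K}.
Proof.
move=> F0 Fstep.
pose U (k : nat) :=
  [set w | exists n, 1 <= k.+1%:R^-1 * F n (graph_after V B n w)].
have mU k : measurable (U k).
  exact: (measurable_ex_graph (fun n g => 1 <= k.+1%:R^-1 * F n g)).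
have PU k : (P (U k) <= (k.+1%:R^-1 * F 0%N one_vertex)%:E)%E.
  apply: (@ville (fun n g => k.+1%:R^-1 * F n g)).
    by move=> n g; rewrite mulr_ge0.
  move=> n g cg g0 _; rewrite /mean_step.
  rewrite (_ : _ * _ = k.+1%:R^-1 * mean_step theta (F n.+1) g).
    by rewrite ler_wpM2l// Fstep.
  rewrite /mean_step mulrCA; congr (_ * _); rewrite mulr_sumr.
  by apply: eq_bigr => v _; ring.
exists (\bigcap_k U k); split.
- by apply: bigcap_measurable => // k _.
- apply/eqP; rewrite eq_le measure_ge0 andbT; apply/lee_addgt0Pr => e e0.
  rewrite add0e; pose k := Num.truncn (F 0%N one_vertex / e).
  apply: (@le_trans _ _ (P (U k))).
    apply: le_measure; rewrite ?inE//; last by move=> w; apply.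
    by apply: bigcap_measurable => // j _.
  apply: (le_trans (PU k)); rewrite lee_fin mulrC ler_pdivrMr//.
  by rewrite mulrC -ler_pdivrMr// ltW// truncnS_gt.
- move=> w /= H k _ /=; apply: contrapT => nU; apply: H; exists k.+1%:R => n.
  rewrite leNgt; apply/negP => /ltW Fn; apply: nU; exists n.
  by rewrite mulrC ler_pdivlMr// mul1r.
Qed.

End Process.

(** * Lyapunov functions and the upper bound on clique sums *)

(** Bernoulli's inequality. *)
Lemma exprDn_ge1 (R : realType) (x : R) n : -1 <= x -> 1 + n%:R * x <= (1 + x) ^+ n.
Proof.
move=> x1; elim: n => [|n IH]; first by rewrite mul0r addr0.
rewrite exprS; apply: (@le_trans _ _ ((1 + x) * (1 + n%:R * x))); last first.
  by rewrite ler_wpM2l// -lerBlDl sub0r.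
rewrite -natr1; have : 0 <= n%:R * x ^+ 2 by rewrite mulr_ge0// sqr_ge0.
by nra.
Qed.

Lemma mean_step_le (R : realType) (theta c : R) (F : graph -> R) g :
  (0 < order g)%N ->
  (forall v, theta * F (duplicate g v) + (1 - theta) * F (delete g v) <= c) ->
  mean_step theta F g <= c.
Proof.
move=> g0 Fc; rewrite /mean_step mulrC ler_pdivrMr ?ltr0n// mulr_natr.
by rewrite -[X in _ *+ X]card_ord -sumr_const; apply: ler_sum => v _.
Qed.

Section Bounds.
Context (R : realType) (d : measure_display) (T : measurableType d)
        (P : probability T R).
Variables (theta : R) (V : nat -> {RV P >-> nat}) (B : nat -> {RV P >-> bool}).
Hypotheses (theta_gt0 : 0 < theta) (theta_lt1 : theta < 1).
Hypothesis dd : duplication_deletion theta V B.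

Let theta_ge0 := ltW theta_gt0.
Let theta_le1 := ltW theta_lt1.
Let theta'_ge0 : 0 <= 1 - theta. Proof. by rewrite subr_ge0. Qed.
Let G := graph_after V B.

Lemma graph_afterP n w : clique_graph (G n w) /\ (0 < order (G n w))%N.
Proof.
elim: n => [|n]; first by split; first exact: clique_graph_one_vertex.
rewrite /G /graph_after /= -/(graph_after V B n w) => -[cg g0].
rewrite /step; case: insubP => // v _ _; case: (B n w); split=> //.
  exact: clique_graph_duplicate.
exact: clique_graph_delete.
Qed.

(** Each step multiplies the mean of [2 ^- N] by [1 - theta / 2], so [r ^+ n * 2 ^- N] is a
    martingale. It is bounded along almost every path, so [2 ^- N] decays like [r ^- n]. *)
Lemma order_to_infty :
  {ae P, forall w, forall K, \forall n \near \oo, (K <= order (G n w))%N}.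
Proof.
pose r := (1 - theta / 2)^-1.
have t2 : 0 < 1 - theta / 2 by have := theta_lt1; lra.
have r0 : 0 < r by rewrite invr_gt0.
have r1 : 1 < r by rewrite invf_gt1//; have := theta_gt0; lra.
pose F (n : nat) g := r ^+ n * 2 ^- order g : R.
have := @supermartingale_bounded _ _ _ P _ _ _ theta_ge0 theta_le1 dd F.
case.
- by move=> n g; rewrite /F mulr_ge0 ?exprn_ge0// ?(ltW r0)// invr_ge0 exprn_ge0.
- move=> n g cg g0; apply: mean_step_le => // v; rewrite /F /= !exprS.
  rewrite [X in X <= _](_ : _ = r * (1 - theta / 2) * (r ^+ n * 2 ^- order g)).
    by rewrite mulVf ?mul1r// gt_eqF.
  rewrite invfM; field.
  by rewrite expf_neq0.
move=> N [mN N0 FN]; exists N; split=> //; apply: subset_trans FN => w /= H.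
apply: contra_not H => -[K FK] k.
pose M := `|K| * 2 ^+ k / (r - 1).
have M0 : 0 <= M by rewrite divr_ge0// ?mulr_ge0// ?exprn_ge0// subr_ge0 ltW.
exists (Num.truncn M).+1 => // n /= Mn; rewrite leqNgt; apply/negP => Nk.
have := FK n; rewrite leNgt => /negP; apply; rewrite /F.
have n1 : M < n%:R.
  by apply: lt_le_trans (truncnS_gt _) _; rewrite ler_nat.
rewrite -/(G n w); apply: (@le_lt_trans _ _ (`|K|)); first exact: ler_norm.
rewrite ltr_pdivlMr ?exprn_gt0//.
apply: (@le_lt_trans _ _ (`|K| * 2 ^+ k)).
  by rewrite ler_wpM2l// ler_weXn2l// ?ler1n// ltnW.
apply: (@lt_le_trans _ _ (1 + n%:R * (r - 1))).
  by move: n1; rewrite /M ltr_pdivrMr ?subr_gt0//; lra.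
have := @exprDn_ge1 R (r - 1) n; rewrite [1 + (r - 1)]addrC subrK; apply.
by lra.
Qed.

(** For functions that are supermartingales only on large graphs: below [N0] vertices the process is
    frozen at [eps]. The order grows by at most one per step, so the freezing ends at exactly [N0]
    vertices, where [F <= eps]. *)
Lemma ville_from (N0 : nat) (eps : R) (F : graph -> R) :
  (forall g, 0 <= F g) ->
  (forall g, clique_graph g -> (0 < order g)%N -> (N0 <= order g)%N ->
    F g < 1 -> mean_step theta F g <= F g) ->
  0 <= eps -> (forall g, clique_graph g -> order g = N0 -> F g <= eps) ->
  (0 < N0)%N ->
  (P [set w | exists n, (N0 <= order (G n w))%N /\ (1 <= F (G n w))%R]
    <= eps%:E)%E.
Proof.
move=> F0 Fstep eps0 Feps N00.
pose F' (n : nat) g := if (N0 <= order g)%N then F g else eps.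
have F'eps g : clique_graph g -> (order g <= N0)%N -> F' 0%N g <= eps.
  move=> cg gN; rewrite /F'; case: ifP => // N0g; apply: Feps => //.
  by apply/eqP; rewrite eqn_leq gN.
apply: (@le_trans _ _
    (P [set w | exists n, (1 <= F' n (graph_after V B n w))%R])).
  apply: le_measure; rewrite ?inE.
  - exact: (measurable_ex_graph V B
      (fun n g => (N0 <= order g)%N /\ (1 <= F g)%R)).
  - exact: (measurable_ex_graph V B (fun n g => (1 <= F' n g)%R)).
  - by move=> w /= [n [Nn Fn]]; exists n; rewrite /F' Nn.
apply: le_trans (ville theta_ge0 theta_le1 dd _ _) _.
- by move=> n g; rewrite /F'; case: ifP.
- move=> n g cg g0; rewrite {1 3}/F'; case: ifP => Ng Fg.
    apply: le_trans (Fstep _ cg g0 Ng Fg); rewrite /mean_step.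
    rewrite ler_wpM2l ?invr_ge0//; apply: ler_sum => v _.
    by rewrite /F' /= Ng (leq_trans Ng).
  apply: mean_step_le => // v.
  have -> : eps = theta * eps + (1 - theta) * eps by ring.
  have gN : (order g < N0)%N by rewrite ltnNge Ng.
  apply: lerD; rewrite ler_wpM2l//; apply: F'eps => //; last exact: ltnW.
    exact: clique_graph_duplicate.
  exact: clique_graph_delete.
- by rewrite lee_fin; apply: F'eps => //; exact: clique_graph_one_vertex.
Qed.

(** The freezing device of [ville_from], now for almost sure boundedness. *)
Lemma supermartingale_from (N0 : nat) (C : R) (F : graph -> R) :
  (forall g, 0 <= F g) ->
  (forall g, clique_graph g -> (0 < order g)%N -> (N0 <= order g)%N ->
    mean_step theta F g <= F g) ->
  (forall g, clique_graph g -> order g = N0 -> F g <= C) ->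
  (0 < N0)%N ->
  {ae P, forall w, exists K : R, \forall n \near \oo, F (G n w) <= K}.
Proof.
move=> F0 Fstep FC N00.
pose F' (n : nat) g := if (N0 <= order g)%N then F g else `|C|.
have F'C g : clique_graph g -> (order g <= N0)%N -> F' 0%N g <= `|C|.
  move=> cg gN; rewrite /F'; case: ifP => // N0g.
  apply: le_trans (ler_norm _); apply: FC => //.
  by apply/eqP; rewrite eqn_leq gN.
have := @supermartingale_bounded _ _ _ P _ _ _ theta_ge0 theta_le1 dd F' _ _.
move=> H; apply: filterS2 order_to_infty (H _ _); last 2 first.
- by move=> n g; rewrite /F'; case: ifP.
- move=> n g cg g0; rewrite {2}/F'; case: ifP => Ng.
    apply: le_trans (Fstep _ cg g0 Ng); rewrite /mean_step.
    rewrite ler_wpM2l ?invr_ge0//; apply: ler_sum => v _.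
    by rewrite /F' /= Ng (leq_trans Ng).
  apply: mean_step_le => // v.
  have -> : `|C| = theta * `|C| + (1 - theta) * `|C| by ring.
  have gN : (order g < N0)%N by rewrite ltnNge Ng.
  apply: lerD; rewrite ler_wpM2l//; apply: F'C => //; last exact: ltnW.
    exact: clique_graph_duplicate.
  exact: clique_graph_delete.
- move=> w /(_ N0) oN [K FK]; exists K; apply: filterS oN => n Nn.
  by have := FK n; rewrite /F' Nn.
Qed.

(** A given clique of size [s] is selected with probability [s / N], so the last hypothesis bounds
    the drift of the sum by [lambda / N] times the sum plus a constant, while [N ^- q] shrinks at a
    rate close to [theta * q / N]. *)
Lemma clique_sum_upper (f : nat -> R) (lambda C : R) (q : nat) :
  (forall s, 0 <= f s) -> f 0%N = 0 -> {homo f : s t / (s <= t)%N >-> s <= t} ->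
  (1 < q)%N -> 0 <= lambda -> lambda < theta * q%:R -> 0 <= C ->
  (forall s, (0 < s)%N ->
    s%:R * (theta * f s.+1 + (1 - theta) * f s.-1 - f s) <=
    lambda * f s + C * s%:R) ->
  {ae P, forall w, exists K : R, \forall n \near \oo,
    clique_sum f (G n w) <= K * (order (G n w))%:R ^+ q}.
Proof.
move=> f0 f00 fh q1 l0 lq C0 fstep.
(* The second term pays for the singleton that each deletion creates. *)
pose C' := C + (1 - theta) * f 1%N.
have C'0 : 0 <= C' by rewrite addr_ge0// mulr_ge0.
(* The expected decrease of [A / N] is then [2 * C' / (N * (N + 1))], which is at least
   [C' * N ^- q] as [q >= 2]. *)
pose A := 2 * C' / theta.
have A0 : 0 <= A by rewrite divr_ge0// mulr_ge0.
pose F g := clique_sum f g / (order g)%:R ^+ q + A / (order g)%:R.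
(* From [N0] on, [lambda / N <= theta * q / (N + q)]. *)
pose N0 := (Num.truncn (lambda * q%:R / (theta * q%:R - lambda))).+1.
have F0 g : 0 <= F g.
  by rewrite addr_ge0// divr_ge0// ?exprn_ge0// clique_sum_ge0.
suff Fstep g : clique_graph g -> (0 < order g)%N -> (N0 <= order g)%N ->
    mean_step theta F g <= F g.
  have := @supermartingale_from N0 (N0%:R * f N0 / N0%:R ^+ q + A / N0%:R) F
    F0 Fstep.
  move=> H; apply: filterS2 order_to_infty (H _ _); last 2 first.
  - move=> g cg gN; rewrite /F gN lerD2r ler_pM2r ?invr_gt0 ?exprn_gt0 ?ltr0n//.
    rewrite -{1}gN; apply: clique_sum_le => // x; apply: fh.
    by rewrite -gN clique_size_le.
  - by [].
  move=> w /(_ 1%N) oN [K FK]; exists K; near=> n.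
  have Nn : (0 < order (G n w))%N by near: n; exact: oN.
  rewrite -ler_pdivrMr ?exprn_gt0 ?ltr0n//.
  apply: (@le_trans _ _ (F (G n w))); last by near: n; exact: FK.
  by rewrite /F lerDl divr_ge0.
move=> cg g0 Ng; rewrite /mean_step.
set N := (order g)%:R; set S := clique_sum f g.
have N1 : 1 <= N by rewrite ler1n.
have Ngt0 : 0 < N by rewrite ltr0n.
have S0 : 0 <= S by exact: clique_sum_ge0.
set w := N ^- q; set w' := (N + 1) ^- q.
have w0 : 0 < w by rewrite invr_gt0 exprn_gt0.
have w'0 : 0 < w' by rewrite invr_gt0 exprn_gt0// addr_gt0.
have ww' : w' <= w * (N / (N + q%:R)).
  have -> : w' = w * ((1 + N^-1) ^+ q)^-1.
    rewrite /w' /w -invfM -exprMn mulrDr mulr1 divff ?gt_eqF//.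
  rewrite ler_pM2l//.
  have -> : N / (N + q%:R) = (1 + q%:R * N^-1)^-1.
    by field; rewrite !gt_eqF// ltr_pwDl.
  have NV0 : 0 < N^-1 by rewrite invr_gt0.
  have b1 : 0 < 1 + q%:R * N^-1 by rewrite ltr_pwDl// mulr_ge0// ltW.
  have b2 : 1 + q%:R * N^-1 <= (1 + N^-1) ^+ q by apply: exprDn_ge1; lra.
  by rewrite lef_pV2 ?posrE// (lt_le_trans b1).
have w'w : w' <= w.
  apply: le_trans ww' _; rewrite ger_pMr// ler_pdivrMr ?mul1r ?lerDl//.
  by rewrite ltr_pwDl.
(* As [f] is monotone and [w' <= w], the increment of [f] under duplication may be weighted by [w],
   which makes the drift of [fstep] appear. *)
have FE v : theta * F (duplicate g v) + (1 - theta) * F (delete g v) <=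
    theta * (S * w' + A / (N + 1)) + (1 - theta) * (S * w + A / N) + w * C' +
    w * lambda * (f (clique_size g v) / (clique_size g v)%:R).
  rewrite /F clique_sum_duplicate// clique_sum_delete//= -/S -/N.
  rewrite -[(order g).+1%:R]natr1 -/N -/w -/w'.
  set k := clique_size g v; have k0 : (0 < k)%N by [].
  have fk : theta * f k.+1 + (1 - theta) * f k.-1 - f k <=
      lambda * (f k / k%:R) + C.
    rewrite -(ler_pM2l (x := k%:R)) ?ltr0n// (le_trans (fstep _ k0))//.
    rewrite mulrDr [k%:R * C]mulrC lerD2r.
    by rewrite mulrCA [k%:R * _]mulrC divfK// pnatr_eq0 -lt0n.
  have fk1 : 0 <= f k.+1 - f k by rewrite subr_ge0 fh.
  have : theta * (f k.+1 - f k) * w' <= theta * (f k.+1 - f k) * w.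
    by rewrite ler_wpM2l// mulr_ge0.
  have : w * (theta * f k.+1 + (1 - theta) * f k.-1 - f k) <=
      w * (lambda * (f k / k%:R) + C) by rewrite ler_pM2l.
  rewrite /C'; move: (A / (N + 1)) (A / N) (f k / k%:R) => a b c.
  nra.
apply: (@le_trans _ _ (theta * (S * w' + A / (N + 1)) +
    (1 - theta) * (S * w + A / N) + w * C' + w * lambda * S / N)).
  apply: (@le_trans _ _ (N^-1 * \sum_(v < order g)
    (theta * (S * w' + A / (N + 1)) + (1 - theta) * (S * w + A / N) + w * C' +
     w * lambda * (f (clique_size g v) / (clique_size g v)%:R)))).
    apply: ler_wpM2l; first by rewrite invr_ge0 ltW.
    by apply: ler_sum => v _; exact: FE.
  rewrite big_split /= -mulr_sumr -/(clique_sum f g) -/S sumr_const card_ord.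
  rewrite -mulr_natl -/N mulrDr mulrA mulVf ?gt_eqF// mul1r lerD2l.
  by rewrite mulrC.
rewrite /F -/S -/N -/w.
have NN0 : lambda * q%:R / (theta * q%:R - lambda) < N.
  by apply: lt_le_trans (truncnS_gt _) _; rewrite ler_nat.
move: NN0; rewrite ltr_pdivrMr ?subr_gt0// => NN0.
have Nq : 0 < N + q%:R by rewrite ltr_pwDl.
have S1 : theta * w' + w * lambda / N <= theta * w.
  have : theta * w' <= theta * (w * (N / (N + q%:R))) by rewrite ler_wpM2l.
  suff : lambda / N <= theta * (1 - N / (N + q%:R)).
    by move=> /(ler_wpM2l (ltW w0)); nra.
  have -> : 1 - N / (N + q%:R) = q%:R / (N + q%:R) by field; rewrite gt_eqF.
  rewrite mulrA ler_pdivrMr// mulrAC ler_pdivlMr//.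
  by nra.
have w2 : w <= 2 / (N * (N + 1)).
  apply: (@le_trans _ _ (N ^- 2)).
    by rewrite lef_pV2 ?posrE ?exprn_gt0// ler_weXn2l.
  rewrite ler_pdivlMr ?mulr_gt0 ?addr_gt0// mulrC ler_pdivrMr ?exprn_gt0//.
  by rewrite expr2; nra.
have C1 : w * C' + theta * (A / (N + 1)) + (1 - theta) * (A / N) <= A / N.
  have AE : theta * (A / N) - theta * (A / (N + 1)) = C' * (2 / (N * (N + 1))).
    by rewrite /A; field; rewrite !gt_eqF// addr_gt0.
  have : C' * w <= C' * (2 / (N * (N + 1))) by rewrite ler_wpM2l.
  by rewrite -AE; lra.
have := ler_wpM2l S0 S1; move: C1.
move: (A / N) (A / (N + 1)) => a b.
have -> : w * lambda * S / N = S * (w * lambda / N) by ring.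
by move: (w * lambda / N) => c; lra.
Unshelve. all: by end_near. Qed.

End Bounds.

(** * Lower bound on clique sums in the supercritical case *)

Section RisingBinomial.
Context {R : realType} (p : nat).

(* [s (s + 1) ... (s + p) / (p + 1)!], a polynomial of degree [p + 1] in [s]. *)
Definition rising_bin (s : nat) : R := 'C(s + p, p.+1)%:R.

Lemma rising_bin0 : rising_bin 0 = 0.
Proof. by rewrite /rising_bin bin_small. Qed.

Lemma rising_bin_ge0 s : 0 <= rising_bin s. Proof. by []. Qed.

Lemma rising_bin_homo : {homo rising_bin : s t / (s <= t)%N >-> s <= t}.
Proof. by move=> s t st; rewrite ler_nat leq_bin2l// leq_add2r. Qed.

(** The discrete form of [x f' = (p + 1) f]. It is exact, which is the advantage of this polynomial
    over a power. *)
Lemma rising_binS s :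
  s%:R * (rising_bin s.+1 - rising_bin s) = p.+1%:R * rising_bin s.
Proof.
rewrite /rising_bin addSn binS natrD [_ + _ - _]addrAC subrr add0r -!natrM.
by rewrite mul_bin_left addnK.
Qed.

(** For the backward difference the exact factor is [s + p]; the surplus [p] is a correction of
    lower order. *)
Lemma rising_bin_pred s : (0 < s)%N ->
  (s + p)%:R * (rising_bin s - rising_bin s.-1) = p.+1%:R * rising_bin s.
Proof.
case: s => // s _; rewrite /rising_bin /= -!natrM -mul_bin_diag.
by rewrite addSn /= binS natrD [_ + _ - _]addrAC subrr add0r natrM.
Qed.

Lemma rising_bin_geid s : s%:R <= rising_bin s.
Proof.
case: s => // s; rewrite ler_nat -(@leq_pmul2l p.+1)// mul_bin_left addnK mulnC.
rewrite leq_mul2l /= -{1}(binSn p) leq_bin2l//.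
by rewrite addSn ltnS leq_addl.
Qed.

Lemma rising_bin_lower s : s%:R ^+ p.+1 <= (p.+1)`!%:R * rising_bin s.
Proof.
rewrite /rising_bin -natrX -natrM ler_nat mulnC bin_ffact.
have H m : (s ^ m <= (s + m.-1) ^_ m)%N.
  elim: m => [|[|m] IH] /=; rewrite ?ffactn0 ?addn0 ?ffactn1 ?expn1//.
  rewrite expnS addnS [leqRHS]ffactnS /= leq_mul//.
  by rewrite leqW ?leq_addr.
exact: H.
Qed.

Lemma rising_bin_upper s : rising_bin s <= (s + p)%:R ^+ p.+1.
Proof.
rewrite /rising_bin -natrX ler_nat (@leq_trans ((s + p) ^_ p.+1))//.
  by rewrite -bin_ffact leq_pmulr// fact_gt0.
elim: p.+1 (s + p)%N => [|m IH] n; first by rewrite ffactn0 expn0.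
rewrite ffactnS expnS leq_mul2l; apply/orP; right.
by rewrite (leq_trans (IH _))//; case: m {IH} => // m; rewrite leq_exp2r ?leq_pred.
Qed.

End RisingBinomial.

Section SupercriticalLower.
Context (R : realType) (d : measure_display) (T : measurableType d)
        (P : probability T R).
Variables (theta : R) (V : nat -> {RV P >-> nat}) (B : nat -> {RV P >-> bool}).
Hypotheses (theta_gt0 : 0 < theta) (theta_lt1 : theta < 1).
Hypothesis dd : duplication_deletion theta V B.

Let G := graph_after V B.

(** The hypothesis compares the relative growth rates, times [N], of [rising_bin q N] and of the
    clique sum, so that their ratio is a supermartingale for large [N]. *)
Lemma clique_sum_rising_lower (p q : nat) :
  theta * q.+1%:R < (2 * theta - 1) * p.+1%:R ->
  {ae P, forall w, exists K : R, \forall n \near \oo,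
    rising_bin q (order (G n w)) <= K * clique_sum (rising_bin p) (G n w)}.
Proof.
move=> qp; set f := @rising_bin R p; set W := @rising_bin R q.
pose p' : R := p.+1%:R; pose q' : R := q.+1%:R.
have {}qp : theta * q' < (2 * theta - 1) * p' by [].
have q0 : 0 <= q' by rewrite ler0n.
have p1 : 1 <= p' by rewrite ler1n.
(* The gap between the rates is [2 * e]; all second-order errors together stay below it. *)
pose e := ((2 * theta - 1) * p' - theta * q') / 2.
have e0 : 0 < e by rewrite divr_gt0// subr_gt0.
have ep : e <= p' / 2.
  rewrite ler_pM2r ?invr_gt0// lerBlDr.
  have : 0 <= theta * q' by rewrite mulr_ge0// ltW.
  have := theta_lt1; nra.
(* With this [eps] the relative jump [p' * h / s] is at most [e / p'], so its square is at most
   [e * h / s]. *)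
pose eps := e / p' ^+ 2.
have eps0 : 0 < eps by rewrite divr_gt0// exprn_gt0// (lt_le_trans _ p1).
pose s0 := (Num.truncn eps^-1).+1.
pose N0 := (Num.truncn (f s0 / eps)).+1.
pose S := clique_sum f.
have SN g : clique_graph g -> (order g)%:R <= S g.
  move=> cg; rewrite -[X in X%:R]card_ord -sumr_const; apply: ler_sum => x _.
  by rewrite ler_pdivlMr ?ltr0n// mul1r rising_bin_geid.
(* Sizes up to [s0] are handled by [S >= N], larger ones by [f k <= S] and the factor [1 / k]. *)
have small g v : clique_graph g -> (N0 <= order g)%N ->
    f (clique_size g v) / (clique_size g v)%:R <= eps * S g.
  move=> cg Ng; set k := clique_size g v.
  have k0 : 0 < k%:R :> R by rewrite ltr0n.
  have [ks|sk] := leqP k s0.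
    apply: (@le_trans _ _ (f s0)).
      rewrite ler_pdivrMr// (le_trans (rising_bin_homo _ ks))//.
      by rewrite ler_peMr// ler1n.
    rewrite mulrC -ler_pdivrMr// (le_trans _ (SN _ cg))//.
    by rewrite (le_trans (ltW (truncnS_gt _)))// ler_nat.
  rewrite ler_pdivrMr//.
  apply: (@le_trans _ _ (1 * S g)).
    by rewrite mul1r; apply: clique_sum_ge => // s; exact: rising_bin_ge0.
  rewrite mulrAC ler_wpM2r ?clique_sum_ge0//.
  rewrite -ler_pdivrMl// mulr1 (le_trans (ltW (truncnS_gt _)))// ler_nat.
  exact: ltnW.
pose F g := W (order g) / S g.
have S0 g : 0 <= S g by exact: clique_sum_ge0.
suff Fstep g : clique_graph g -> (0 < order g)%N -> (N0 <= order g)%N ->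
    mean_step theta F g <= F g.
  have F0 g : 0 <= F g by rewrite divr_ge0.
  have H := @supermartingale_from _ _ _ _ _ _ _ theta_gt0 theta_lt1 dd
    N0 (W N0) F F0 Fstep.
  apply: filterS2 (order_to_infty theta_gt0 theta_lt1 dd) (H _ _) => //.
  - move=> w /(_ 1%N) oN [K FK]; exists K; near=> n.
    have [cg _] := graph_afterP V B n w.
    have Nn : (0 < order (G n w))%N by near: n; exact: oN.
    rewrite -ler_pdivrMr; first by near: n; exact: FK.
    by apply: lt_le_trans (SN _ cg); rewrite ltr0n.
  - move=> g cg gN; rewrite /F gN ler_pdivrMr; last first.
      by apply: lt_le_trans (SN _ cg); rewrite gN ltr0n.
    by rewrite ler_peMr// (le_trans _ (SN _ cg))// gN ler1n.
move=> cg g0 Ng; rewrite /mean_step.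
set N := (order g)%:R; set s := S g.
have N1 : 1 <= N by rewrite ler1n.
have Ngt0 : 0 < N by rewrite ltr0n.
have sN : N <= s by exact: SN.
have s_gt0 : 0 < s by exact: lt_le_trans sN.
set w := W (order g); set w' := W (order g).+1.
have w0 : 0 <= w by [].
have w'E : w' = w * (1 + q' / N).
  have := rising_binS (R := R) q (order g); rewrite -/N -/w -/w' -/q' => H.
  have -> : w' = w + N^-1 * (N * (w' - w)) by field; rewrite gt_eqF.
  by rewrite H; ring.
have FE v : theta * F (duplicate g v) + (1 - theta) * F (delete g v) <=
   (theta * w' + (1 - theta) * w) / s +
   ((1 - theta) * w * (p' / s ^+ 2 + 2 * e / s ^+ 2) -
     theta * w' * (p' / s ^+ 2 - e / s ^+ 2)) *
   (f (clique_size g v) / (clique_size g v)%:R).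
  rewrite /F /S clique_sum_duplicate// clique_sum_delete//;
    last exact: rising_bin0.
  rewrite /= -/S -/s -/w -/w'.
  have := small _ v cg Ng; rewrite -/s.
  have := rising_binS (R := R) p (clique_size g v).
  have := rising_bin_pred (R := R) p (clique_size_gt0 v).
  have : 0 <= f (clique_size g v) - f (clique_size g v).-1.
    by rewrite subr_ge0 rising_bin_homo// leq_pred.
  rewrite -/f -/p'.
  set k := clique_size g v; set h := f k / k%:R => y0.
  have k0 : 0 < k%:R :> R by rewrite ltr0n.
  have h0 : 0 <= h by rewrite divr_ge0.
  have fE : f k = k%:R * h by rewrite /h mulrCA divff ?mulr1// gt_eqF.
  rewrite natrD [in p' * f k]fE => yE.
  rewrite mulrCA -[degree v]/(k.-1) => /(mulfI (lt0r_neq0 k0)) uE hs.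
  set y := f k - f k.-1 in y0 yE.
  have yh : y <= p' * h.
    rewrite -(ler_pM2l k0) [X in _ <= X]mulrCA -yE mulrDl lerDl.
    by rewrite mulr_ge0.
  have p0 : 0 < p' by exact: lt_le_trans p1.
  have phs : p' * h <= e / p' * s.
    have -> : e / p' * s = p' * (eps * s).
      by rewrite /eps expr2; field; rewrite gt_eqF.
    by rewrite ler_pM2l.
  have phs2 : p' * h <= s / 2.
    apply: le_trans phs _; rewrite mulrC ler_pM2l//.
    by rewrite ler_pdivrMr// mulrC.
  have ph2 : (p' * h) ^+ 2 <= e * h * s.
    have := ler_wpM2l (mulr_ge0 (ltW p0) h0) phs.
    have -> : p' * h * (e / p' * s) = e * h * s by field; rewrite gt_eqF.
    by rewrite expr2.
  (* Both reciprocals are expanded to first order; the remainder is [e * h / s ^ 2] for duplication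
     and twice that for deletion. *)
  have uB : (s + p' * h)^-1 <= s^-1 - p' * h / s ^+ 2 + e * h / s ^+ 2.
    have u0 : 0 <= p' * h by rewrite mulr_ge0 ?(ltW p0).
    have su : 0 < s + p' * h by rewrite ltr_pwDl.
    rewrite -[X in X <= _]mul1r ler_pdivrMr//.
    have -> : (s^-1 - p' * h / s ^+ 2 + e * h / s ^+ 2) * (s + p' * h) =
        1 + (e * h * s - (p' * h) ^+ 2 + p' * h * (e * h)) / s ^+ 2.
      by field; rewrite gt_eqF.
    rewrite lerDl; apply: divr_ge0; last by rewrite exprn_ge0 ?ltW.
    apply: addr_ge0; first by rewrite subr_ge0.
    by rewrite mulr_ge0// mulr_ge0// ltW.
  have yB : (s - y)^-1 <= s^-1 + p' * h / s ^+ 2 + 2 * e * h / s ^+ 2.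
    have sy : 0 < s - y by rewrite subr_gt0; lra.
    apply: (@le_trans _ _ (s - p' * h)^-1).
      by rewrite lef_pV2 ?posrE//; lra.
    have su : 0 < s - p' * h by lra.
    rewrite -[X in X <= _]mul1r ler_pdivrMr//.
    have -> : (s^-1 + p' * h / s ^+ 2 + 2 * e * h / s ^+ 2) * (s - p' * h) =
        1 + (2 * (e * h) * (s - p' * h) - (p' * h) ^+ 2) / s ^+ 2.
      by field; rewrite gt_eqF.
    rewrite lerDl; apply: divr_ge0; last by rewrite exprn_ge0 ?ltW.
    rewrite subr_ge0 (le_trans ph2)//.
    have eh0 : 0 <= e * h by rewrite mulr_ge0// ltW.
    have s2 : s <= 2 * (s - p' * h) by lra.
    by have := ler_wpM2l eh0 s2; lra.
  have -> : s + f k.+1 - f k = s + p' * h by rewrite -addrA uE.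
  (* The singleton created by a deletion only enlarges the denominator. *)
  have yB' : (s + f k.-1 - f k + f 1%N)^-1 <= (s - y)^-1.
    have f1 : 0 <= f 1%N by [].
    have sy : 0 < s - y by rewrite subr_gt0; lra.
    have sy' : s - y <= s + f k.-1 - f k + f 1%N.
      have -> : s + f k.-1 - f k + f 1%N = s - y + f 1%N by rewrite /y; ring.
      by rewrite lerDl.
    by rewrite lef_pV2 ?posrE// (lt_le_trans sy).
  have T1 : theta * (w' / (s + p' * h)) <=
      theta * w' * (s^-1 - p' * h / s ^+ 2 + e * h / s ^+ 2).
    by rewrite mulrA ler_wpM2l// mulr_ge0// ltW.
  have T2 : (1 - theta) * (w / (s + f k.-1 - f k + f 1%N)) <=
      (1 - theta) * w * (s^-1 + p' * h / s ^+ 2 + 2 * e * h / s ^+ 2).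
    rewrite mulrA; apply: ler_wpM2l; last exact: le_trans yB.
    by rewrite mulr_ge0// subr_ge0 ltW.
  apply: le_trans (lerD T1 T2) _; rewrite le_eqVlt; apply/orP; left; apply/eqP.
  by ring.
apply: (@le_trans _ _ ((theta * w' + (1 - theta) * w) / s +
   ((1 - theta) * w * (p' / s ^+ 2 + 2 * e / s ^+ 2) -
     theta * w' * (p' / s ^+ 2 - e / s ^+ 2)) * s / N)).
  apply: (@le_trans _ _ (N^-1 * \sum_(v < order g)
    ((theta * w' + (1 - theta) * w) / s +
   ((1 - theta) * w * (p' / s ^+ 2 + 2 * e / s ^+ 2) -
     theta * w' * (p' / s ^+ 2 - e / s ^+ 2)) *
   (f (clique_size g v) / (clique_size g v)%:R)))).
    apply: ler_wpM2l; first by rewrite invr_ge0 ltW.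
    by apply: ler_sum => v _; exact: FE.
  rewrite big_split /= sumr_const card_ord -mulr_sumr.
  rewrite -/(clique_sum f g) -/(S g) -/s.
  rewrite -[_ *+ order g]mulr_natl -/N le_eqVlt; apply/orP; left; apply/eqP.
  by field; rewrite !gt_eqF.
rewrite /F -/S -/s -/w w'E.
(* By the choice of [e], the numerator over the last [N] is [- theta * e] minus a nonnegative
   term. *)
have -> : (theta * (w * (1 + q' / N)) + (1 - theta) * w) / s +
   ((1 - theta) * w * (p' / s ^+ 2 + 2 * e / s ^+ 2) -
     theta * (w * (1 + q' / N)) * (p' / s ^+ 2 - e / s ^+ 2)) * s / N =
   w / s * (1 + (theta * q' + (1 - theta) * (p' + 2 * e) -
     theta * (p' - e) - theta * (q' / N) * (p' - e)) / N).
  by field; rewrite !gt_eqF.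
have qN : 0 <= theta * (q' / N) * (p' - e).
  apply: mulr_ge0; last by have := ep; lra.
  by rewrite mulr_ge0 ?divr_ge0// ltW.
rewrite ler_piMr ?divr_ge0 ?(ltW s_gt0)// gerDl.
rewrite ler_pdivrMr// mul0r.
have : 2 * e = (2 * theta - 1) * p' - theta * q' by rewrite /e; field.
have : theta * e <= e by rewrite ler_piMl// ltW.
have := e0; have := mulr_ge0 (ltW theta_gt0) (ltW e0).
move: (theta * (q' / N) * (p' - e)) qN => X; lra.
Unshelve. all: by end_near. Qed.

End SupercriticalLower.

(** * Inequalities for the barriers *)

Lemma expR_le_quadratic (R : realType) (x : R) : 0 <= x -> x <= 2^-1 ->
  expR x <= 1 + x + 2 * x ^+ 2.
Proof.
move=> x0 x1; have e1 := expR_ge1Dx (- x); rewrite expRN in e1.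
have x2 : 0 < 1 - x by lra.
have -> : expR x = ((expR x)^-1)^-1 by rewrite invrK.
apply: (@le_trans _ _ (1 - x)^-1).
  by rewrite lef_pV2 ?posrE ?invr_gt0 ?expR_gt0.
rewrite -[X in X <= _]mul1r ler_pdivrMr//.
have : 0 <= x ^+ 2 * (1 - 2 * x) by rewrite mulr_ge0 ?sqr_ge0//; lra.
by lra.
Qed.

Lemma expRN_le_quadratic (R : realType) (x : R) : 0 <= x ->
  expR (- x) <= 1 - x + x ^+ 2.
Proof.
move=> x0; have e1 := expR_ge1Dx x; rewrite expRN.
have x2 : 0 < 1 + x by lra.
apply: (@le_trans _ _ (1 + x)^-1).
  by rewrite lef_pV2 ?posrE ?expR_gt0.
rewrite -[X in X <= _]mul1r ler_pdivrMr//.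
have : 0 <= x ^+ 3 by rewrite exprn_ge0.
by lra.
Qed.

Lemma ln_le_id (R : realType) (x : R) : 0 < x -> ln x <= x.
Proof.
move=> x0; rewrite -ler_expR lnK ?posrE//.
by apply: le_trans (expR_ge1Dx x); rewrite lerDr.
Qed.

(** * Counting the vertices in cliques of a given size *)

Section SizeCount.
Variable R : realType.

Definition size_count (s : nat) (g : graph) : R :=
  \sum_(x < order g) (clique_size g x == s)%:R.

Lemma size_countE s g : (0 < s)%N ->
  size_count s g = clique_sum (fun k => s%:R * (k == s)%:R) g.
Proof.
move=> s0; apply: eq_bigr => x _; case: eqP => [->|_].
  by rewrite mulr1 divff// pnatr_eq0 -lt0n.
by rewrite mulr0 mul0r.
Qed.

Lemma size_count_duplicate s g v : clique_graph g -> (0 < s)%N ->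
  size_count s (duplicate g v) = size_count s g +
   s%:R * (((clique_size g v).+1 == s)%:R - (clique_size g v == s)%:R).
Proof. by move=> cg s0; rewrite !size_countE// clique_sum_duplicate//; ring. Qed.

Lemma size_count_delete s g v : clique_graph g -> (0 < s)%N ->
  size_count s (delete g v) = size_count s g +
   s%:R * (((clique_size g v).-1 == s)%:R - (clique_size g v == s)%:R +
           (1%N == s)%:R).
Proof.
move=> cg s0; rewrite !size_countE// clique_sum_delete//; first ring.
by case: s s0 => // s _; rewrite mulr0.
Qed.

Lemma size_count_ge0 s g : 0 <= size_count s g.
Proof. exact: sumr_ge0. Qed.

Lemma size_count_le s g : size_count s g <= (order g)%:R.
Proof.
rewrite -[X in X%:R]card_ord -sumr_const; apply: ler_sum => x _.
by case: (_ == _); rewrite ?ler01.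
Qed.

Lemma size_count_gt0 s g : 0 < size_count s g -> exists x, clique_size g x = s.
Proof.
move=> g0; apply: contrapT => nx; move: g0; rewrite /size_count big1 ?ltxx//.
by move=> x _; case: eqP => // xs; exfalso; apply: nx; exists x.
Qed.

Lemma mean_step_sum (theta : R) (F : nat -> graph -> R) (g : graph) m n :
  mean_step theta (fun h => \sum_(m <= s < n) F s h) g =
  \sum_(m <= s < n) mean_step theta (F s) g.
Proof.
rewrite /mean_step -mulr_sumr exchange_big /=; congr (_ * _).
by apply: eq_bigr => v _; rewrite big_split/= !mulr_sumr.
Qed.

End SizeCount.

(** * The drift of a single level as an inequality between reals *)

Section BarrierAlgebra.
Variable R : realType.

(* [u], [um], [up] are the fractions of vertices in cliques of size [s],
   [s - 1] and [s + 1], with [i = 1 / s]. The barrier is [a - rho] at [s], and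
   [u] exceeds it by at most [rho * m * i / 8]. *)
Lemma barrier_drift (theta m i a rho um up u ebeta ealpha ey : R) :
  0 < theta -> theta < 1 -> 0 < m -> m <= 1 -> 0 < i -> i <= 1 ->
  0 <= a -> a <= 1 -> 0 <= rho -> 0 <= u -> u <= 1 -> 0 <= um -> um <= 1 ->
  0 <= up ->
  a * (1 + (theta + m) * i) - rho <= theta * um + (1 - theta) * up ->
  u <= a - rho + rho * m * i / 8 ->
  let z := m * i / 16 in
  ebeta <= z + 2 * z ^+ 2 -> z - z ^+ 2 <= ealpha -> ealpha <= 1 ->
  0 <= ebeta ->
  ey <= 1 + z * i * a + 2 * (z * i * a) ^+ 2 ->
  1 <= ey ->
  theta * (ey * (1 - ealpha * um + ebeta * u)) +
  (1 - theta) * (1 - ealpha * up + ebeta * u) <= 1.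
Proof.
move=> t0 t1 m0 m1 i0 i1 a0 a1 r0 u0 u1 um0 um1 up0 wlow uup z be al al1 b0 ye y1.
have mi0 : 0 < m * i by rewrite mulr_gt0.
have mi1 : m * i <= 1 by nra.
(* [z] is the change of the exponent when one clique enters or leaves size [s]; margin and errors
   are all measured in [z]. *)
have zE : m * i = 16 * z by rewrite /z; lra.
clearbody z.
have z0 : 0 < z by lra.
have z1 : z <= 16^-1 by lra.
have X0 : 0 <= 1 - ealpha * um.
  have : ealpha * um <= 1 * um by rewrite ler_wpM2r.
  by lra.
have bu : ebeta * u <= ebeta by rewrite ler_piMr.
have zz : z ^+ 2 <= z / 16 by rewrite expr2 ler_pM2l//; lra.
have b1 : ebeta <= 2 * z by lra.
have ia1 : i * a <= 1 by rewrite mulr_ile1// ltW.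
have y2 : z * i * a <= z by rewrite -mulrA ler_piMr// ltW.
have y20 : 0 <= z * i * a by rewrite !mulr_ge0// ltW.
have ey1 : ey - 1 <= z * i * a * (1 + 2 * z).
  have : (z * i * a) * (z * i * a) <= (z * i * a) * z by rewrite ler_wpM2l.
  by lra.
have X1 : 1 - ealpha * um + ebeta * u <= 1 + 2 * z.
  have az : 0 <= z - z ^+ 2 by lra.
  have : 0 <= ealpha * um by rewrite mulr_ge0// (le_trans az).
  by lra.
have T1 : ey * (1 - ealpha * um + ebeta * u) <=
    1 - ealpha * um + ebeta * u + z * i * a * (1 + 2 * z) * (1 + 2 * z).
  have : (ey - 1) * (1 - ealpha * um + ebeta * u) <= (ey - 1) * (1 + 2 * z).
    by rewrite ler_wpM2l// subr_ge0.
  have : (ey - 1) * (1 + 2 * z) <= z * i * a * (1 + 2 * z) * (1 + 2 * z).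
    by rewrite ler_wpM2r//; lra.
  by lra.
set w := theta * um + (1 - theta) * up in wlow.
have w0 : 0 <= w by rewrite /w addr_ge0 ?mulr_ge0 ?subr_ge0// ltW.
have T2 : z * (1 - z) * (a * (1 + (theta + m) * i) - rho) <= ealpha * w.
  apply: (@le_trans _ _ (z * (1 - z) * w)).
    by apply: ler_wpM2l => //; apply: mulr_ge0; lra.
  by apply: ler_wpM2r => //; lra.
have T3 : ebeta * u <= z * (1 + 2 * z) * (a - rho + rho * m * i / 8).
  apply: (@le_trans _ _ (z * (1 + 2 * z) * u)).
    by apply: ler_wpM2r => //; lra.
  by apply: ler_wpM2l => //; apply: mulr_ge0; lra.
have T4 : theta * (z * i * a * (1 + 2 * z) * (1 + 2 * z)) <=
    z * (theta * i * a * (1 + 5 * z)).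
  have -> : theta * (z * i * a * (1 + 2 * z) * (1 + 2 * z)) =
      z * (theta * i * a * ((1 + 2 * z) * (1 + 2 * z))) by ring.
  rewrite ler_pM2l// ler_wpM2l//; last first.
    have := zz; lra.
  by rewrite mulr_ge0// mulr_ge0// ltW.
suff : z * (theta * i * a * (1 + 5 * z)) +
    z * (1 + 2 * z) * (a - rho + rho * m * i / 8) <=
    z * (1 - z) * (a * (1 + (theta + m) * i) - rho).
  have := ler_wpM2l (ltW t0) T1; rewrite /w in T2.
  have T2' : theta * (ealpha * um) + (1 - theta) * (ealpha * up) =
     ealpha * (theta * um + (1 - theta) * up) by ring.
  move: (ealpha * um) (ealpha * up) (ebeta * u) T1 T2 T2' T3 => *.
  lra.
have H : theta * i * a * (1 + 5 * z) + (1 + 2 * z) * (a - rho + rho * m * i / 8) <=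
    (1 - z) * (a * (1 + (theta + m) * i) - rho).
  (* The count is nonnegative and at most slightly above its barrier, which bounds [rho] by a
     multiple of [a]. *)
  have ar : rho * (1 - m * i / 8) <= a.
    have : 0 <= a - rho + rho * m * i / 8 by exact: le_trans uup.
    by lra.
  have ar' : rho <= 8 / 7 * a.
    have : rho * (7 / 8) <= rho * (1 - m * i / 8) by rewrite ler_wpM2l//; lra.
    by lra.
  have Z1 : z * (theta + m) * i <= 2 * z.
    have ti : (theta + m) * i <= 2 by nra.
    by rewrite -mulrA [2 * z]mulrC ler_pM2l.
  have Z2 : theta * i * (5 * z) <= 5 * z.
    have ti : theta * i <= 1 by nra.
    by rewrite ler_piMl//; lra.
  (* Of the margin [16 * z] the errors take at most [3 * z + 2 * z + 5 * z], which leaves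
     [6 * z = 3 / 8 * m * i]. *)
  have br : m * i * (3 / 8) <=
      (1 - z) * (1 + (theta + m) * i) - (1 + 2 * z) - theta * i * (1 + 5 * z).
    have -> : (1 - z) * (1 + (theta + m) * i) - (1 + 2 * z) -
        theta * i * (1 + 5 * z) =
      m * i - 3 * z - z * (theta + m) * i - theta * i * (5 * z) by ring.
    by rewrite zE; lra.
  have := ler_wpM2l a0 br.
  have rl : (1 + 2 * z) * (rho * m * i / 8) <= a * (m * i * (3 / 8)).
    have : (1 + 2 * z) * (rho * (m * i / 8)) <= 9 / 8 * (8 / 7 * a * (m * i / 8)).
      apply: ler_pM; try lra.
        by rewrite mulr_ge0//; lra.
      by rewrite ler_wpM2r//; lra.
    have : 0 <= a * (m * i) by rewrite mulr_ge0// ltW.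
    by lra.
  have : 0 <= z * rho by rewrite mulr_ge0// ltW.
  by lra.
have := ler_wpM2l (ltW z0) H; lra.
Qed.

(** The level [s = 1] is fed by every deletion, through the factor [ez] close to [1 - z]. As
    [a <= (1 - theta) / 8], this outweighs the rise of the barrier and the loss of singletons. *)
Lemma barrier_drift1 (theta m a u ebeta ez ey : R) :
  0 < theta -> theta < 1 -> 0 < m -> m <= 1 -> 0 <= a ->
  a <= (1 - theta) / 8 -> 0 <= u -> u <= a ->
  let z := m / 16 in
  0 <= ebeta -> ebeta <= z + 2 * z ^+ 2 -> 0 <= ez -> ez <= 1 - z + z ^+ 2 ->
  0 <= ey -> ey <= 1 + z * a + 2 * (z * a) ^+ 2 ->
  theta * (ey * (1 + ebeta * u)) + (1 - theta) * (ez * (1 + ebeta * u)) <= 1.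
Proof.
move=> t0 t1 m0 m1 a0 at_ u0 ua z b0 be e0 ez1 y0 ye.
have z0 : 0 < z by rewrite /z; lra.
have z1 : z <= 16^-1 by rewrite /z; lra.
have zz : z ^+ 2 <= z / 16 by rewrite expr2 ler_pM2l//; lra.
have b2 : ebeta <= 2 * z by lra.
have za : 0 <= z * a by rewrite mulr_ge0// ltW.
have ye2 : ey <= 1 + 2 * (z * a).
  have a1 : a <= 1 by lra.
  have : (z * a) * (z * a) <= (z * a) * 16^-1.
    by apply: ler_wpM2l => //; apply: le_trans z1; rewrite ler_piMr// ltW.
  by lra.
have bu : ebeta * u <= 2 * (z * a) by rewrite mulrA ler_pM.
have S : theta * ey + (1 - theta) * ez <=
    1 + 2 * (z * a) - 15 / 16 * (z * (1 - theta)).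
  have h1 : theta * ey <= theta * (1 + 2 * (z * a)) by rewrite ler_wpM2l// ltW.
  have h2 : theta * (z * a) <= z * a by rewrite ler_piMl// ltW.
  have h3 : (1 - theta) * ez <= (1 - theta) * (1 - 15 / 16 * z).
    apply: ler_wpM2l; first by rewrite subr_ge0 ltW.
    by apply: le_trans ez1 _; lra.
  lra.
have zt : z * a <= z * (1 - theta) / 8 by rewrite -mulrA ler_wpM2l// ltW.
have zt0 : 0 < z * (1 - theta) by rewrite mulr_gt0// subr_gt0.
have S1 : theta * ey + (1 - theta) * ez <= 1 - 2 * (z * a) by lra.
have S0 : 0 <= theta * ey + (1 - theta) * ez.
  by rewrite addr_ge0// mulr_ge0// ?subr_ge0 ltW.
have -> : theta * (ey * (1 + ebeta * u)) + (1 - theta) * (ez * (1 + ebeta * u)) =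
  (theta * ey + (1 - theta) * ez) * (1 + ebeta * u) by ring.
apply: (@le_trans _ _ ((1 - 2 * (z * a)) * (1 + 2 * (z * a)))).
  by rewrite ler_pM// ?lerD2l// addr_ge0// mulr_ge0.
have : 0 <= (z * a) ^+ 2 by rewrite sqr_ge0.
lra.
Qed.

End BarrierAlgebra.

(** * Barriers for the clique size counts *)

Section Barrier.
Context (R : realType) (d : measure_display) (T : measurableType d)
        (P : probability T R).
Variables (theta : R) (V : nat -> {RV P >-> nat}) (B : nat -> {RV P >-> bool}).
Hypotheses (theta_gt0 : 0 < theta) (theta_lt1 : theta < 1).
Hypothesis dd : duplication_deletion theta V B.

(* [c_rec] with [m = 0] and equality is the equation satisfied by the limit of
   [size_count s / N]; [m] is the margin that absorbs the fluctuations. *)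
Variables (c : nat -> R) (m C : R).
Hypotheses (c_ge0 : forall s, 0 <= c s) (c_le1 : forall s, c s <= 1).
Hypotheses (m_gt0 : 0 < m) (m_le1 : m <= 1) (C_ge1 : 1 <= C).
Hypothesis c_rec : forall s, (1 < s)%N ->
  c s * (1 + (theta + m) / s%:R) <= theta * c s.-1 + (1 - theta) * c s.+1.
Hypothesis c_small : forall s N : nat, (0 < N)%N ->
  C * ln N%:R ^+ 2 < s%:R -> c s <= N%:R^-1.

Let G := graph_after V B.

(* The factor 1536 makes the contribution of a level far above its barrier at
   most [N ^- 6], see [level_margin]. [A] is kept abstract because conversion
   would expand the numeral. *)
Variable A : R.
Hypotheses (A_ge0 : 0 <= A) (A_eq : A = 1536 * (4 * C) ^+ 3 / m ^+ 2).

Let slack (N : nat) : R := A * ln N%:R ^+ 7.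
(** A clique entering or leaving size [s] moves the count by [s], hence the exponent of [level] by
    [m / (16 * s)]. For [s > 0], a level below 1 means that the count is above its barrier. *)
Let rate (s : nat) : R := m / (16 * s%:R ^+ 2).
Let barrier (N0 s N : nat) : R := N%:R * c s / N0%:R - slack N.
Let level (N0 s : nat) (g : graph) : R :=
  expR (rate s * (barrier N0 s (order g) - size_count R s g)).
(** From this size on [c s <= 1 / N], so that the barrier is nonpositive once [ln N >= 1]. *)
Let top (N : nat) : nat := (Num.truncn (C * ln N%:R ^+ 2)).+1.

Let rate_gt0 s : (0 < s)%N -> 0 < rate s.
Proof. by move=> s0; rewrite divr_gt0// mulr_gt0// exprn_gt0// ltr0n. Qed.

Let C_ge0 : 0 <= C. Proof. exact: le_trans C_ge1. Qed.

Let C4 : 4 <= 4 * C. Proof. have := C_ge1; lra. Qed.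

(** For a count at least [slack N * m / (8 * s)] above its barrier, half of this distance covers the
    change [1 + s] of one step and the other half gives an exponent of [6 * ln N]. The factor
    [4 * C] in place of [C] includes the sizes below [top N.+1]. *)
Let level_margin (s N : nat) : (0 < s)%N -> 1 <= ln N%:R :> R ->
  s%:R <= 4 * C * ln N%:R ^+ 2 ->
  2 * (1 + s%:R) <= slack N * m / (8 * s%:R) /\
  6 * ln N%:R <= rate s * (slack N * m / (8 * s%:R)) / 2.
Proof.
move=> s0; rewrite /slack A_eq /rate; move: (ln N%:R) (4 * C) C4 => l D D4 l1 sl.
have s1 : 1 <= s%:R :> R by rewrite ler1n.
have m0' := m_gt0; have m1' := m_le1.
move: (s%:R) s1 sl => x x1 xl {s0}.
have x0 : 0 < x by lra.
have D0 : 0 < D by lra.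
have l0 : 0 < l by lra.
split.
  apply: (@le_trans _ _ (4 * x)); first lra.
  rewrite ler_pdivlMr ?mulr_gt0//.
  have -> : 1536 * D ^+ 3 / m ^+ 2 * l ^+ 7 * m = 1536 * D ^+ 3 * l ^+ 7 / m.
    by field; rewrite gt_eqF.
  rewrite ler_pdivlMr//.
  have x2 : x ^+ 2 <= D ^+ 2 * l ^+ 4.
    have -> : D ^+ 2 * l ^+ 4 = (D * l ^+ 2) ^+ 2 by ring.
    by rewrite ler_pXn2r// nnegrE ltW// mulr_gt0// exprn_gt0.
  have y0 : 0 <= D ^+ 2 * l ^+ 4 by rewrite mulr_ge0// exprn_ge0// ltW.
  have y1 : D ^+ 2 * l ^+ 4 <= D ^+ 3 * l ^+ 7.
    rewrite ler_pM ?exprn_ge0 ?(ltW D0) ?(ltW l0)//; rewrite ler_weXn2l//; lra.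
  have x3 : x ^+ 2 * m <= D ^+ 3 * l ^+ 7.
    apply: le_trans y1; apply: le_trans x2.
    by rewrite ler_piMr// sqr_ge0.
  have -> : 4 * x * (8 * x) * m = 32 * (x ^+ 2 * m) by ring.
  have : 0 <= D ^+ 3 * l ^+ 7 by apply: le_trans y1.
  by rewrite -[1536 * _ * _]mulrA; move: (D ^+ 3 * l ^+ 7) x3 => y; lra.
(* Here [1536 = 6 * 16 * 8 * 2]; six of the seven logarithms compensate [x ^ 3], since
   [x <= D * l ^ 2]. *)
have -> : m / (16 * x ^+ 2) * (1536 * D ^+ 3 / m ^+ 2 * l ^+ 7 * m / (8 * x)) / 2 =
    6 * (D ^+ 3 * l ^+ 7 / x ^+ 3).
  by field; rewrite !gt_eqF// ?exprn_gt0.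
rewrite ler_pM2l// ler_pdivlMr ?exprn_gt0//.
have -> : D ^+ 3 * l ^+ 7 = l * (D * l ^+ 2) ^+ 3 by ring.
by rewrite ler_pM2l// ler_pXn2r// nnegrE ltW// mulr_gt0// exprn_gt0.
Qed.

Let slack_homo N : (0 < N)%N -> slack N <= slack N.+1.
Proof.
move=> N0; rewrite /slack ler_wpM2l//.
have l0 : 0 <= ln N%:R :> R by rewrite ln_ge0// ler1n.
have ll : ln N%:R <= ln N.+1%:R :> R.
  by rewrite ler_ln ?posrE ?ltr0n// ler_nat.
by rewrite ler_pXn2r// ?nnegrE// (le_trans l0).
Qed.

Let barrierS N0 s N : (0 < N0)%N -> (0 < N)%N ->
  barrier N0 s N.+1 <= barrier N0 s N + c s / N0%:R.
Proof.
move=> N00 N_gt0; rewrite /barrier -natr1.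
have := slack_homo N_gt0.
have -> : (N%:R + 1) * c s / N0%:R = N%:R * c s / N0%:R + c s / N0%:R.
  by rewrite mulrDl mulrDl mul1r.
lra.
Qed.

Let c_div N0 s : (0 < N0)%N -> 0 <= c s / N0%:R <= N0%:R^-1.
Proof.
move=> N00; rewrite divr_ge0//=.
by rewrite ler_pdivrMr ?ltr0n// mulVf// pnatr_eq0 -lt0n.
Qed.

Let expR_ln6 (N : nat) : (0 < N)%N -> expR (- (6 * ln N%:R)) = N%:R ^- 6 :> R.
Proof.
by move=> N0; rewrite expRN -[6]/(6%:R) expRM_natl lnK// posrE ltr0n.
Qed.

Let level_far N0 s g (v : 'I_(order g)) : clique_graph g -> (0 < N0)%N ->
  (0 < s)%N -> 1 <= ln (order g)%:R :> R ->
  s%:R <= 4 * C * ln (order g)%:R ^+ 2 ->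
  barrier N0 s (order g) + slack (order g) * m / (8 * s%:R) <= size_count R s g ->
  [/\ level N0 s g <= (order g)%:R ^- 6,
      level N0 s (duplicate g v) <= (order g)%:R ^- 6 &
      level N0 s (delete g v) <= (order g)%:R ^- 6].
Proof.
move=> cg N00 s0 l1 sl far.
have g0 : (0 < order g)%N by case: (order g) v => // -[].
have [sl1 sl2] := level_margin s0 l1 sl.
have /andP[c0 c1] := c_div s N00.
have c1' : c s / N0%:R <= 1.
  by rewrite (le_trans c1)// invf_le1 ?ltr0n// ler1n.
have r0 := rate_gt0 s0.
have s_ge0 : 0 <= s%:R :> R by [].
suff H x : x <= 1 + s%:R - slack (order g) * m / (8 * s%:R) ->
    expR (rate s * x) <= (order g)%:R ^- 6.
  split; apply: H => /=.
  - by move: far sl1; move: (_ / (8 * _)) => X; lra.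
  - rewrite size_count_duplicate//.
    have := barrierS s N00 g0.
    have := mulr_ge0 s_ge0 (ler0n R ((clique_size g v).+1 == s)).
    have : s%:R * (clique_size g v == s)%:R <= s%:R :> R.
      by rewrite ler_piMr//; case: eqP.
    rewrite mulrBr; move: far sl1; move: (_ / (8 * _)) => X.
    move: (_ * _%:R) => Y; move: (s%:R * _%:R) => Z; lra.
  - rewrite size_count_delete//.
    have := mulr_ge0 s_ge0 (ler0n R ((clique_size g v).-1 == s)).
    have := mulr_ge0 s_ge0 (ler0n R (1 == s)).
    have : s%:R * (clique_size g v == s)%:R <= s%:R :> R.
      by rewrite ler_piMr//; case: eqP.
    rewrite mulrDr mulrBr; move: far sl1; move: (_ / (8 * _)) => X.
    move: (_ * _%:R) => Y; move: (s%:R * _%:R) => Z; move: (s%:R * _%:R) => W.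
    lra.
move=> xH; rewrite -expR_ln6// ler_expR.
have : rate s * x <= rate s * (1 + s%:R - slack (order g) * m / (8 * s%:R)).
  by rewrite ler_pM2l.
have : rate s * (2 * (1 + s%:R)) <= rate s * (slack (order g) * m / (8 * s%:R)).
  by rewrite ler_pM2l.
by move: sl2; move: (_ / (8 * _)) => X; lra.
Qed.

Let avg_indicators (L k0 k1 k2 k3 : R) (s1 s2 s3 : nat) g : (0 < order g)%N ->
  (order g)%:R^-1 * \sum_(v < order g) (L * (k0 +
    k1 * (clique_size g v == s1)%:R + k2 * (clique_size g v == s2)%:R +
    k3 * (clique_size g v == s3)%:R)) =
  L * (k0 + k1 * (size_count R s1 g / (order g)%:R) +
    k2 * (size_count R s2 g / (order g)%:R) +
    k3 * (size_count R s3 g / (order g)%:R)).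
Proof.
move=> g0; rewrite -mulr_sumr !big_split /= -!mulr_sumr sumr_const card_ord.
rewrite -[k0 *+ _]mulr_natl /size_count.
have g0' : (order g)%:R != 0 :> R by rewrite pnatr_eq0 -lt0n.
move: (\sum_(v < order g) (clique_size g v == s1)%:R).
move: (\sum_(v < order g) (clique_size g v == s2)%:R).
move: (\sum_(v < order g) (clique_size g v == s3)%:R) => a b e.
by move: (order g)%:R g0' => N N0; field.
Qed.

(** At most one indicator is 1, so the exponential is affine in them and can be averaged by
    [avg_indicators]. *)
Let expR_indicators (z : R) (a b : bool) : ~~ (a && b) ->
  expR (- (z * (a%:R - b%:R))) = 1 - (1 - expR (- z)) * a%:R + (expR z - 1) * b%:R.
Proof.
case: a; case: b => // _; rewrite ?subr0 ?sub0r ?subrr ?mulr1 ?mulrN1 ?mulr0 ?opprK ?oppr0 ?expR0; ring.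
Qed.

Let slack_ge0 N : (0 < N)%N -> 0 <= slack N.
Proof. by move=> N0; rewrite mulr_ge0// exprn_ge0// ln_ge0// ler1n. Qed.

(** Near the barrier the drift matters: the neighbouring counts are above their own barriers, so for
    [s > 1] the inequality [c_rec] makes the count rise faster on average than its barrier. *)
Let level_near N0 s g : clique_graph g -> (0 < order g)%N -> (0 < N0)%N ->
  N0%:R^-1 <= (1 - theta) / 8 -> (0 < s)%N ->
  (forall j, (0 < j)%N -> barrier N0 j (order g) <= size_count R j g) ->
  size_count R s g <=
    barrier N0 s (order g) + slack (order g) * m / (8 * s%:R) ->
  mean_step theta (level N0 s) g <= level N0 s g.
Proof.
move=> cg g0 N00 N0t s0 above near.
have /andP[a0 a1'] := c_div s N00.
set N : R := (order g)%:R; have Ngt0 : 0 < N by rewrite ltr0n.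
set L := level N0 s g; have L0 : 0 <= L by exact: expR_ge0.
pose i : R := s%:R^-1; pose z := m * i / 16; pose a := c s / N0%:R.
have sR0 : 0 < s%:R :> R by rewrite ltr0n.
have i0 : 0 < i by rewrite invr_gt0.
have i1 : i <= 1 by rewrite invf_le1// ler1n.
have mi1 : m * i <= 1 by rewrite mulr_ile1// ltW.
have z0 : 0 < z by rewrite divr_gt0// mulr_gt0.
have z1 : z <= 2^-1 by rewrite /z; lra.
have zE : rate s * s%:R = z.
  by rewrite /rate /z /i; field; rewrite gt_eqF.
have ziaE : rate s * a = z * i * a.
  by rewrite /rate /z /i; field; rewrite gt_eqF.
have a1 : a <= 1 by apply: le_trans a1' _; rewrite invf_le1 ?ltr0n// ler1n.
have zia0 : 0 <= z * i * a by rewrite mulr_ge0// mulr_ge0// ltW.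
have zia1 : z * i * a <= 2^-1.
  apply: le_trans z1; rewrite -mulrA ler_piMr ?(ltW z0)//.
  by rewrite mulr_ile1// ltW.
pose u := size_count R s g / N.
have u0 : 0 <= u by rewrite divr_ge0// size_count_ge0.
have u1 : u <= 1 by rewrite ler_pdivrMr// mul1r size_count_le.
have barN j : barrier N0 j (order g) / N = c j / N0%:R - slack (order g) / N.
  rewrite /barrier -/N mulrBl; congr (_ - _).
  by rewrite mulrAC -[_ * c j / N]mulrA mulrCA divff ?mulr1// gt_eqF.
pose rho := slack (order g) / N.
have rho0 : 0 <= rho by rewrite divr_ge0// slack_ge0.
have uup : u <= a - rho + rho * m * i / 8.
  rewrite ler_pdivrMr//; apply: le_trans near _.
  have := barN s; rewrite -/a -/rho => barE.
  have -> : barrier N0 s (order g) = (a - rho) * N.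
    by rewrite -barE divfK// gt_eqF.
  rewrite [X in _ <= X]mulrDl lerD2l le_eqVlt; apply/orP; left; apply/eqP.
  by rewrite /rho /i; field; rewrite !gt_eqF.
have beta0 : 0 <= expR z - 1 by rewrite subr_ge0 (le_trans _ (expR_ge1Dx z))// lerDl ltW.
have beta1 : expR z - 1 <= z + 2 * z ^+ 2.
  by have := expR_le_quadratic (ltW z0) z1; lra.
have alpha1 : z - z ^+ 2 <= 1 - expR (- z).
  by have := expRN_le_quadratic (ltW z0); lra.
have alpha2 : 1 - expR (- z) <= 1 by rewrite gerBl expR_ge0.
have ey1 := expR_le_quadratic zia0 zia1.
have ey2 : 1 <= expR (z * i * a) by rewrite (le_trans _ (expR_ge1Dx _))// lerDl.
have levdup v : level N0 s (duplicate g v) <= L * (expR (z * i * a) *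
    expR (- (z * (((clique_size g v).+1 == s)%:R - (clique_size g v == s)%:R)))).
  rewrite /L /level -!expRD ler_expR size_count_duplicate//=.
  have := ler_wpM2l (ltW (rate_gt0 s0)) (barrierS s N00 g0).
  rewrite -/a [rate s * (_ + a)]mulrDr ziaE.
  rewrite -zE; lra.
have levdel v : level N0 s (delete g v) = L *
    expR (- (z * (((clique_size g v).-1 == s)%:R - (clique_size g v == s)%:R +
       (1%N == s)%:R))).
  rewrite /L /level -!expRD size_count_delete//= -zE; congr expR; ring.
case: (ltnP 1 s) => [s2|].
  have levE v : theta * level N0 s (duplicate g v) +
      (1 - theta) * level N0 s (delete g v) <=
    L * ((theta * expR (z * i * a) + (1 - theta)) +
     - (theta * expR (z * i * a) * (1 - expR (- z))) *
       (clique_size g v == s.-1)%:R +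
     - ((1 - theta) * (1 - expR (- z))) * (clique_size g v == s.+1)%:R +
     (theta * expR (z * i * a) + (1 - theta)) * (expR z - 1) *
       (clique_size g v == s)%:R).
    rewrite levdel (_ : (1%N == s) = false) ?addr0; last by apply/negbTE; rewrite neq_ltn s2.
    rewrite (_ : ((clique_size g v).-1 == s) = (clique_size g v == s.+1))//.
    have e1 : ((clique_size g v).+1 == s) = (clique_size g v == s.-1).
      by rewrite -[in LHS](prednK s0) eqSS.
    have := levdup v; rewrite e1 => ld.
    rewrite expR_indicators in ld; last first.
      by apply/negP => /andP[/eqP -> /eqP]; move: s2; clear; lia.
    rewrite expR_indicators; last first.
      by apply/negP => /andP[/eqP -> /eqP]; clear; lia.
    have := ler_wpM2l (ltW theta_gt0) ld; lra.
  apply: le_trans (_ : _ <= N^-1 * \sum_(v < order g)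
    (L * ((theta * expR (z * i * a) + (1 - theta)) +
     - (theta * expR (z * i * a) * (1 - expR (- z))) *
       (clique_size g v == s.-1)%:R +
     - ((1 - theta) * (1 - expR (- z))) * (clique_size g v == s.+1)%:R +
     (theta * expR (z * i * a) + (1 - theta)) * (expR z - 1) *
       (clique_size g v == s)%:R))) _.
    rewrite /mean_step; apply: ler_wpM2l; first by rewrite invr_ge0 ltW.
    by apply: ler_sum => v _; exact: levE.
  rewrite avg_indicators// -[X in _ <= X]mulr1 ler_wpM2l//.
  set um := size_count R s.-1 g / _; set up := size_count R s.+1 g / _.
  have um0 : 0 <= um by rewrite divr_ge0// size_count_ge0.
  have um1 : um <= 1 by rewrite ler_pdivrMr// mul1r size_count_le.
  have up0 : 0 <= up by rewrite divr_ge0// size_count_ge0.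
  have s10 : (0 < s.-1)%N by move: s2; clear; lia.
  have wlow : a * (1 + (theta + m) * i) - rho <= theta * um + (1 - theta) * up.
    have hm : c s.-1 / N0%:R - rho <= um.
      by rewrite -barN ler_pM2r ?invr_gt0// above.
    have hp : c s.+1 / N0%:R - rho <= up.
      by rewrite -barN ler_pM2r ?invr_gt0// above.
    have := ler_wpM2l (ltW theta_gt0) hm.
    have t' : 0 <= 1 - theta by rewrite subr_ge0 ltW.
    have := ler_wpM2l t' hp.
    have N0V : 0 <= N0%:R^-1 :> R by [].
    have := ler_wpM2r N0V (c_rec s2); rewrite -/i.
    have -> : c s * (1 + (theta + m) * i) / N0%:R = a * (1 + (theta + m) * i).
      by rewrite /a mulrAC.
    move: (c s.-1) (c s.+1) (N0%:R^-1 : R) => *; lra.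
  have := @barrier_drift R theta m i a rho um up u (expR z - 1) (1 - expR (- z))
    (expR (z * i * a)) theta_gt0 theta_lt1 m_gt0 m_le1 i0 i1 a0 a1 rho0 u0 u1
    um0 um1 up0 wlow uup beta1 alpha1 alpha2 beta0 ey1 ey2.
  rewrite -/u -/N; lra.
rewrite leq_eqVlt ltnS leqNgt s0 orbF => /eqP s1.
have i1E : i = 1 by rewrite /i s1 invr1.
have zE1 : z = m / 16 by rewrite /z i1E mulr1.
have levE v : theta * level N0 s (duplicate g v) +
    (1 - theta) * level N0 s (delete g v) <=
  L * ((theta * expR (z * i * a) + (1 - theta) * expR (- z)) +
   (theta * expR (z * i * a) + (1 - theta) * expR (- z)) * (expR z - 1) *
     (clique_size g v == s)%:R + 0 * (clique_size g v == s)%:R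
    + 0 * (clique_size g v == s)%:R).
  have ld := levdup v.
  have e1 : ((clique_size g v).+1 == s) = false by rewrite s1.
  rewrite e1 (@expR_indicators z false) ?mulr0 ?subr0// in ld.
  (* Every deletion creates a singleton; the second one, left over from a clique of size 2, is
     dropped. *)
  have ldel : level N0 s (delete g v) <=
      L * (expR (- z) * (1 + (expR z - 1) * (clique_size g v == s)%:R)).
    have ind := @expR_indicators z false (clique_size g v == s) isT.
    rewrite mulr0 subr0 in ind.
    rewrite levdel ler_wpM2l// -ind -expRD ler_expR s1 eqxx.
    rewrite (_ : true%:R = 1 :> R)// (_ : false%:R = 0 :> R)//.
    have : 0 <= z * ((clique_size g v).-1 == 1)%:R by rewrite mulr_ge0// ltW.
    lra.
  have := ler_wpM2l (ltW theta_gt0) ld.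
  have t' : 0 <= 1 - theta by rewrite subr_ge0 ltW.
  have := ler_wpM2l t' ldel; lra.
apply: le_trans (_ : _ <= N^-1 * \sum_(v < order g)
  (L * ((theta * expR (z * i * a) + (1 - theta) * expR (- z)) +
   (theta * expR (z * i * a) + (1 - theta) * expR (- z)) * (expR z - 1) *
     (clique_size g v == s)%:R + 0 * (clique_size g v == s)%:R
    + 0 * (clique_size g v == s)%:R))) _.
  rewrite /mean_step; apply: ler_wpM2l; first by rewrite invr_ge0 ltW.
  by apply: ler_sum => v _; exact: levE.
rewrite avg_indicators// -[X in _ <= X]mulr1 ler_wpM2l//.
have ua : u <= a.
  apply: le_trans uup _; rewrite -lerBrDl -subr_ge0.
  have : rho * (m * i) <= rho by rewrite ler_piMr.
  by rewrite mulrA; lra.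
have at8 : a <= (1 - theta) / 8 by exact: le_trans N0t.
have := @barrier_drift1 R theta m a u (expR z - 1) (expR (- z))
    (expR (z * i * a)) theta_gt0 theta_lt1 m_gt0 m_le1 a0 at8 u0 ua.
rewrite -zE1 => /(_ beta0 beta1 (expR_ge0 _) (expRN_le_quadratic (ltW z0))
  (expR_ge0 _)).
rewrite i1E mulr1 in ey1 * => /(_ ey1); rewrite -/u -/N; lra.
Qed.

Let top_le s N : (s < top N)%N -> s%:R <= C * ln N%:R ^+ 2.
Proof.
by rewrite ltnS truncn_ge_nat// mulr_ge0 ?C_ge0 ?sqr_ge0.
Qed.

Let top_gt s N : (top N <= s)%N -> C * ln N%:R ^+ 2 < s%:R.
Proof.
by rewrite truncn_lt_nat// mulr_ge0 ?C_ge0 ?sqr_ge0.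
Qed.

Let lnS_le N : 1 <= ln N%:R :> R -> ln N.+1%:R <= 2 * ln N%:R :> R.
Proof.
move=> l1; have N2 : (1 < N)%N.
  case: N l1 => [|[|]]//; first by rewrite ln0// ler10.
  by rewrite ln1 ler10.
rewrite mulr_natl -lnXn ?ltr0n ?(ltnW N2)// ler_ln ?posrE ?exprn_gt0 ?ltr0n//.
  by rewrite -natrX ler_nat; move: N2; clear; nia.
by rewrite ltnW.
Qed.

Let lnS_sqr N : 1 <= ln N%:R :> R -> C * ln N.+1%:R ^+ 2 <= 4 * C * ln N%:R ^+ 2.
Proof.
move=> l1; have l0 : 0 <= ln N.+1%:R :> R by rewrite ln_ge0// ler1n.
have -> : 4 * C * ln N%:R ^+ 2 = C * (2 * ln N%:R) ^+ 2 by ring.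
rewrite ler_wpM2l ?C_ge0// ler_pXn2r ?nnegrE ?lnS_le//.
by apply: le_trans (lnS_le l1).
Qed.

Let slack_ge s N : (0 < s)%N -> 1 <= ln N%:R :> R ->
  s%:R <= 4 * C * ln N%:R ^+ 2 -> 1 + slack N * m / (8 * s%:R) <= slack N.
Proof.
move=> s0 l1 sl; have [h _] := level_margin s0 l1 sl.
have s1 : 1 <= s%:R :> R by rewrite ler1n.
suff : slack N * m / (8 * s%:R) <= slack N / 8.
  by move: (slack N * m / _) h => X; lra.
have sN0 : 0 <= slack N by rewrite mulr_ge0// exprn_ge0// (le_trans _ l1).
rewrite ler_pdivrMr ?mulr_gt0 ?ltr0n// mulrA divfK//.
rewrite ler_pM// ?(ltW m_gt0)//.
exact: le_trans s1.
Qed.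

Let K : R := 8 * C / theta.
(* The term [K / N] compensates the errors [N ^- 6] of the levels. *)
Let total (N0 : nat) (g : graph) : R :=
  \sum_(1 <= s < top (order g)) level N0 s g + K / (order g)%:R.

Let K_ge0 : 0 <= K.
Proof. by rewrite divr_ge0 ?(ltW theta_gt0)// mulr_ge0// (le_trans _ C_ge1). Qed.

Let total_ge0 N0 g : 0 <= total N0 g.
Proof.
apply: addr_ge0; last by rewrite divr_ge0.
by apply: sumr_ge0 => s _; exact: expR_ge0.
Qed.

Let top_homo N : (0 < N)%N -> (top N <= top N.+1)%N.
Proof.
move=> N0; rewrite ltnS truncn_ge_nat; last by rewrite mulr_ge0 ?C_ge0 ?sqr_ge0.
apply: (@le_trans _ _ (C * ln N%:R ^+ 2)).
  by rewrite truncn_le mulr_ge0 ?C_ge0 ?sqr_ge0.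
have l0 : 0 <= ln N%:R :> R by rewrite ln_ge0// ler1n.
have ll : ln N%:R <= ln N.+1%:R :> R.
  by rewrite ler_ln ?posrE ?ltr0n// ler_nat.
rewrite ler_wpM2l ?C_ge0// ler_pXn2r// nnegrE//.
exact: le_trans ll.
Qed.

(** Below [top] each level is at most [total], hence below 1; from [top] on the barriers are
    nonpositive. *)
Let above_barrier N0 g : (0 < N0)%N -> (0 < order g)%N ->
  1 <= ln (order g)%:R :> R -> total N0 g < 1 ->
  forall s, (0 < s)%N -> barrier N0 s (order g) <= size_count R s g.
Proof.
move=> N00 g0 l1 F1 s s0.
have [st|ts] := ltnP s (top (order g)).
  have : level N0 s g < 1.
    apply: le_lt_trans F1; rewrite /total (big_rem s) /=; last first.
      by rewrite mem_index_iota s0.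
    rewrite -addrA lerDl; apply: addr_ge0; last by rewrite divr_ge0.
    by apply: sumr_ge0 => j _; exact: expR_ge0.
  by rewrite -[X in _ < X]expR0 ltr_expR pmulr_rlt0 ?rate_gt0// subr_lt0 => /ltW.
apply: le_trans (size_count_ge0 _ _ _); rewrite subr_le0.
have C1 : 1%:R <= 4 * C * ln (order g)%:R ^+ 2.
  have ll : 1 <= ln (order g)%:R ^+ 2 :> R by rewrite exprn_ege1.
  rewrite -[X in X%:R]mul1n natrM ler_pM//.
  by have := C4; lra.
have h := slack_ge (isT : 0 < 1)%N l1 C1.
apply: (@le_trans _ _ 1); last first.
  apply: le_trans h; rewrite lerDl divr_ge0// mulr_ge0 ?(ltW m_gt0)//.
  exact: slack_ge0.
rewrite ler_pdivrMr ?ltr0n// mul1r.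
apply: (@le_trans _ _ 1); last by rewrite ler1n.
by rewrite mulrC -ler_pdivlMr ?ltr0n// mul1r; apply: c_small => //; exact: top_gt.
Qed.

(** The crude bound [ln N <= N] leaves at most [4 * C * N ^ 2] terms. *)
Let top_tiny N n : (0 < N)%N -> 1 <= ln N%:R :> R -> (n <= top N.+1)%N ->
  \sum_(1 <= s < n) N%:R ^- 6 <= 4 * C / N%:R ^+ 4.
Proof.
move=> N0 l1 nt; have NR : 0 < N%:R :> R by rewrite ltr0n.
rewrite sumr_const_nat -[_ ^- 6 *+ _]mulr_natl.
apply: (@le_trans _ _ (4 * C * N%:R ^+ 2 / N%:R ^+ 6)); last first.
  by rewrite le_eqVlt; apply/orP; left; apply/eqP; field; rewrite gt_eqF.
rewrite ler_pM2r ?invr_gt0 ?exprn_gt0//.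
case: n nt => [|n] nt; first by rewrite sub0n !mulr_ge0 ?C_ge0.
rewrite subSS subn0; apply: le_trans (top_le nt) _.
apply: le_trans (lnS_sqr l1) _; rewrite ler_wpM2l ?mulr_ge0 ?C_ge0//.
by rewrite ler_pXn2r ?nnegrE// ?ln_le_id// (le_trans _ l1).
Qed.

(** A level that joins the sum because [top] moves has a negative barrier and is in the far zone, so
    it contributes only [N ^- 6]. *)
Let level_mean N0 s g : clique_graph g -> (0 < order g)%N -> (0 < N0)%N ->
  N0%:R^-1 <= (1 - theta) / 8 -> (0 < s)%N -> (s < top (order g).+1)%N ->
  1 <= ln (order g)%:R :> R ->
  (forall j, (0 < j)%N -> barrier N0 j (order g) <= size_count R j g) ->
  mean_step theta (level N0 s) g <=
    (if (s < top (order g))%N then level N0 s g else 0) + (order g)%:R ^- 6.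
Proof.
move=> cg g0 N00 N0t s0 st l1 above.
have sl := le_trans (top_le st) (lnS_sqr l1).
have NV : 0 <= (order g)%:R ^- 6 :> R by rewrite invr_ge0 exprn_ge0.
have L0 : 0 <= level N0 s g by exact: expR_ge0.
have [far|near] := leP (barrier N0 s (order g) +
    slack (order g) * m / (8 * s%:R)) (size_count R s g).
  apply: (@le_trans _ _ ((order g)%:R ^- 6)); last first.
    by rewrite lerDr; case: ifP.
  apply: mean_step_le => // v.
  have [_ h1 h2] := level_far v cg N00 s0 l1 sl far.
  have := ler_wpM2l (ltW theta_gt0) h1.
  have t' : 0 <= 1 - theta by rewrite subr_ge0 ltW.
  by have := ler_wpM2l t' h2; lra.
case: ifPn => [_|].
  apply: le_trans (level_near cg g0 N00 N0t s0 above (ltW near)) _.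
  by rewrite lerDl.
rewrite -leqNgt => ts; exfalso; move: near; rewrite ltNge => /negP; apply.
apply: le_trans (size_count_ge0 _ _ _).
have := slack_ge s0 l1 sl; rewrite /barrier.
suff : (order g)%:R * c s / N0%:R <= 1 by move: (_ / (8 * _)) => X; lra.
rewrite ler_pdivrMr ?ltr0n// mul1r.
apply: (@le_trans _ _ 1); last by rewrite ler1n.
by rewrite mulrC -ler_pdivlMr ?ltr0n// mul1r; apply: c_small => //; exact: top_gt.
Qed.

Let total_step N0 g : clique_graph g -> (0 < order g)%N -> (0 < N0)%N ->
  N0%:R^-1 <= (1 - theta) / 8 -> 1 <= ln (order g)%:R :> R ->
  total N0 g < 1 -> mean_step theta (total N0) g <= total N0 g.
Proof.
move=> cg g0 N00 N0t l1 F1.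
have above := above_barrier N00 g0 l1 F1.
set N : R := (order g)%:R; have Ngt0 : 0 < N by rewrite ltr0n.
pose H h := \sum_(1 <= s < top (order g).+1) level N0 s h.
have t' : 0 <= 1 - theta by rewrite subr_ge0 ltW.
have step1 : mean_step theta (total N0) g <=
    mean_step theta H g + (theta * (K / (N + 1)) + (1 - theta) * (K / N)).
  apply: (@le_trans _ _ (N^-1 * \sum_(v < order g)
     ((theta * H (duplicate g v) + (1 - theta) * H (delete g v)) +
      (theta * (K / (N + 1)) + (1 - theta) * (K / N))))).
    apply: ler_wpM2l; first by rewrite invr_ge0 ltW.
    apply: ler_sum => v _; rewrite /total /= -natr1 -/N -/(H _).
    (* A deletion does not move [top]; its sum is extended to [top N.+1] by nonnegative terms. *)
    have : \sum_(1 <= s < top (order g)) level N0 s (delete g v) <=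
        H (delete g v).
      rewrite /H [leRHS](@big_cat_nat _ _ _ (top (order g))) ?top_homo//=.
      by rewrite lerDl sumr_ge0// => s _; exact: expR_ge0.
    by move=> /(ler_wpM2l t'); lra.
  rewrite big_split /= mulrDr lerD2l sumr_const card_ord.
  set k := (X in X *+ _); rewrite -[k *+ _]mulr_natl mulKf// gt_eqF//.
apply: le_trans step1 _; rewrite mean_step_sum.
have step2 : \sum_(1 <= s < top (order g).+1) mean_step theta (level N0 s) g <=
    \sum_(1 <= s < top (order g)) level N0 s g + 4 * C / N ^+ 4.
  apply: (@le_trans _ _ (\sum_(1 <= s < top (order g).+1)
    ((if (s < top (order g))%N then level N0 s g else 0) + N ^- 6))).
    by apply: ler_sum_nat => s /andP[s0 st]; exact: level_mean.
  rewrite big_split /= lerD ?top_tiny//.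
  rewrite (@big_cat_nat _ _ _ (top (order g))) ?top_homo//=.
  rewrite [X in _ + X]big_nat_cond [X in _ + X]big1 ?addr0; last first.
    by move=> s /andP[/andP[+ _] _]; rewrite leqNgt => /negbTE ->.
  by apply: ler_sum_nat => s /andP[_ ->].
apply: le_trans (lerD step2 (lexx _)) _; rewrite /total -/N -!addrA lerD2l.
have N1 : 1 <= N by rewrite ler1n.
(* The [theta] in the denominator of [K] cancels the probability of a duplication, the only move
   that lowers [K / N]. *)
have KE : K / N - (theta * (K / (N + 1)) + (1 - theta) * (K / N)) =
    8 * C / (N * (N + 1)).
  rewrite /K; field; rewrite !gt_eqF// addr_gt0//.
suff : 4 * C / N ^+ 4 <= 8 * C / (N * (N + 1)).
  by rewrite -KE; move: (K / (N + 1)) (K / N) => x y; lra.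
have C0 : 0 < C by exact: lt_le_trans C_ge1.
have NN : N <= N ^+ 2 by rewrite expr2 ler_peMl// ltW.
have NNN : N ^+ 2 <= N ^+ 4 by rewrite ler_weXn2l.
rewrite ler_pdivrMr ?exprn_gt0// mulrAC ler_pdivlMr ?mulr_gt0 ?addr_gt0//.
have : N * (N + 1) <= 2 * N ^+ 4 by rewrite mulrDr mulr1 -expr2; lra.
move=> /(ler_wpM2l (ltW C0)); lra.
Qed.

(** With [N0] vertices the barrier is [c s] minus the slack, and [c s <= 1], so every level starts
    in the far zone. *)
Let total_start N0 g : clique_graph g -> order g = N0 -> (0 < N0)%N ->
  1 <= ln N0%:R :> R -> total N0 g <= (4 * C + K) / N0%:R.
Proof.
move=> cg gN; subst N0 => N00 l1; rewrite /total mulrDl lerD2r.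
have NR : 1 <= (order g)%:R :> R by rewrite ler1n.
apply: (@le_trans _ _ (4 * C / (order g)%:R ^+ 4)); last first.
  rewrite ler_wpM2l ?mulr_ge0 ?C_ge0// lef_pV2 ?posrE ?exprn_gt0 ?ltr0n//.
  by rewrite -[leLHS]expr1 ler_weXn2l.
apply: le_trans (top_tiny N00 l1 (top_homo N00)).
apply: ler_sum_nat => s /andP[s0 st].
have sl : s%:R <= 4 * C * ln (order g)%:R ^+ 2.
  apply: le_trans (top_le st) _; rewrite -[4 * C * _]mulrA.
  have : 0 <= C * ln (order g)%:R ^+ 2 by rewrite mulr_ge0 ?C_ge0 ?sqr_ge0.
  by move: (C * _) => X; lra.
have [] // := level_far (Ordinal N00) cg N00 s0 l1 sl.
apply: le_trans (size_count_ge0 _ _ _).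
have := slack_ge s0 l1 sl; rewrite /barrier.
suff : (order g)%:R * c s / (order g)%:R <= 1 by move: (_ / (8 * _)) => X; lra.
by rewrite ler_pdivrMr ?ltr0n// mul1r ler_piMr// ltW// ltr0n.
Qed.

(** Breaking a barrier started at [N0] has probability at most a constant over [N0], so almost
    surely some [N0], depending on the path, survives. *)
Lemma size_count_lower : {ae P, forall w, exists2 N0 : nat, (0 < N0)%N &
  forall n s, (N0 <= order (G n w))%N -> (0 < s)%N ->
  (order (G n w))%:R * c s / N0%:R - A * ln (order (G n w))%:R ^+ 7 <=
  size_count R s (G n w)}.
Proof.
(* From [n0] on, [1 <= ln N] and [1 / N <= (1 - theta) / 8]. *)
pose n0 := ((Num.truncn (expR 1 : R)).+1 + (Num.truncn (8 / (1 - theta))).+1)%N.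
have n0_gt0 : (0 < n0)%N by [].
have ln_n0 N : (n0 <= N)%N -> 1 <= ln N%:R :> R.
  move=> n0N; have N0 := leq_trans n0_gt0 n0N.
  rewrite -ler_expR lnK ?posrE ?ltr0n// ltW// (lt_le_trans (truncnS_gt _))//.
  by rewrite ler_nat (leq_trans _ n0N)// leq_addr.
have n0_t N : (n0 <= N)%N -> N%:R^-1 <= (1 - theta) / 8.
  move=> n0N; have N0 := leq_trans n0_gt0 n0N.
  have t' : 0 < 1 - theta by rewrite subr_gt0.
  rewrite -[X in _ <= X]invrK lef_pV2 ?posrE ?invr_gt0 ?divr_gt0 ?ltr0n//.
  rewrite invfM invrK mulrC ltW// (lt_le_trans (truncnS_gt _))//.
  by rewrite ler_nat (leq_trans _ n0N)// leq_addl.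
pose W (N0 : nat) :=
  [set w | exists n, (N0 <= order (G n w))%N /\ 1 <= total N0 (G n w)].
have mW N0 : measurable (W N0).
  exact: (measurable_ex_graph V B
    (fun n g => (N0 <= order g)%N /\ 1 <= total N0 g)).
have PW N0 : (n0 <= N0)%N -> (P (W N0) <= ((4 * C + K) / N0%:R)%:E)%E.
  move=> n0N; have N00 := leq_trans n0_gt0 n0N.
  apply: (ville_from theta_gt0 theta_lt1 dd) => //.
  - move=> g cg g0 Ng F1; apply: total_step => //; first exact: n0_t.
    by apply: ln_n0; exact: leq_trans Ng.
  - by rewrite divr_ge0// addr_ge0// mulr_ge0 ?C_ge0.
  - by move=> g cg gN; apply: total_start => //; exact: ln_n0.
have mI : measurable (\bigcap_(N0 in [set N | (n0 <= N)%N]) W N0).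
  apply: bigcap_measurable => [|N _]; last exact: mW.
  by exists n0 => /=.
exists (\bigcap_(N0 in [set N | (n0 <= N)%N]) W N0); split=> //.
- apply/eqP; rewrite eq_le measure_ge0 andbT; apply/lee_addgt0Pr => e e0.
  rewrite add0e; pose k := (n0 + (Num.truncn ((4 * C + K) / e)).+1)%N.
  have n0k : (n0 <= k)%N by rewrite leq_addr.
  apply: (@le_trans _ _ (P (W k))).
    by apply: le_measure; rewrite ?inE// => w; apply.
  apply: (le_trans (PW k n0k)).
  rewrite lee_fin ler_pdivrMr ?ltr0n ?(leq_trans n0_gt0 n0k)//.
  rewrite -ler_pdivrMl// mulrC; apply: le_trans (ltW (truncnS_gt _)) _.
  by rewrite ler_nat leq_addl.
- move=> w /= H N0 /= n0N; apply: contrapT => nW; apply: H.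
  have N00 := leq_trans n0_gt0 n0N.
  exists N0 => // n s Nn s0.
  have [cg g0] := graph_afterP V B n w.
  apply: above_barrier => //; first by apply: ln_n0; exact: leq_trans Nn.
  by rewrite ltNge; apply/negP => F1; apply: nW; exists n.
Qed.

End Barrier.

(** * Limits inferior and superior *)

Section Limits.
Variable R : realType.
Implicit Types (u : nat -> R) (a : R).

Lemma le_limn_einf u a : (\forall n \near \oo, a <= u n) ->
  (a%:E <= limn_einf (fun n => (u n)%:E))%E.
Proof.
move=> [n0 _ au]; rewrite limn_einf_lim; apply: lime_ge.
  exact: is_cvg_einfs.
near=> n; apply/ereal_infP => _ [k /= nk <-]; rewrite lee_fin; apply: au.
by apply: leq_trans nk; near: n; exists n0.
Unshelve. all: by end_near. Qed.

Lemma limn_esup_le u a : (\forall n \near \oo, u n <= a) ->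
  (limn_esup (fun n => (u n)%:E) <= a%:E)%E.
Proof.
move=> [n0 _ au]; rewrite limn_esup_lim; apply: lime_le.
  exact: is_cvg_esups.
near=> n; apply/ereal_supP => _ [k /= nk <-]; rewrite lee_fin; apply: au.
by apply: leq_trans nk; near: n; exists n0.
Unshelve. all: by end_near. Qed.

(** The term of degree [k + 1] of the exponential series suffices. *)
Lemma expR_gt_monomial (a K : R) (k : nat) : 0 < a ->
  exists2 x0, 1 <= x0 & forall x, x0 <= x -> K * x ^+ k < expR (a * x).
Proof.
move=> a0; pose M := `|K| * (k.+1)`!%:R / a ^+ k.+1.
have M0 : 0 <= M by rewrite divr_ge0 ?mulr_ge0// exprn_ge0// ltW.
exists (1 + M) => [|x Mx]; first by rewrite lerDl.
have x0 : 0 < x by apply: lt_le_trans Mx; rewrite ltr_pwDl.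
have ax0 : 0 <= a * x by rewrite mulr_ge0// ltW.
apply: lt_le_trans (expR_ge1Dxn k ax0).
apply: (@le_lt_trans _ _ ((a * x) ^+ k.+1 / (k.+1)`!%:R)); last by rewrite ltrDr.
apply: (@le_trans _ _ (`|K| * x ^+ k)).
  by rewrite ler_wpM2r ?ler_norm// exprn_ge0// ltW.
have -> : (a * x) ^+ k.+1 / (k.+1)`!%:R =
    a ^+ k.+1 / (k.+1)`!%:R * x * x ^+ k.
  by rewrite exprMn [x ^+ k.+1]exprS; field; rewrite pnatr_eq0 -lt0n fact_gt0.
rewrite ler_wpM2r ?exprn_ge0 ?(ltW x0)//.
have f0 : (k.+1)`!%:R != 0 :> R by rewrite pnatr_eq0 -lt0n fact_gt0.
have -> : `|K| = a ^+ k.+1 / (k.+1)`!%:R * M.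
  by rewrite /M; field; rewrite f0 andbT expf_neq0// gt_eqF.
rewrite ler_wpM2l ?divr_ge0 ?exprn_ge0 ?(ltW a0)//.
by apply: le_trans Mx; rewrite lerDr.
Qed.

End Limits.

(** * From clique statistics to the maximal degree *)

Section Cases.
Context (R : realType) (d : measure_display) (T : measurableType d)
        (P : probability T R).
Variables (theta : R) (V : nat -> {RV P >-> nat}) (B : nat -> {RV P >-> bool}).
Hypotheses (theta_gt0 : 0 < theta) (theta_lt1 : theta < 1).
Hypothesis dd : duplication_deletion theta V B.

Let N n w : R := (nb_vertices V B n w)%:R.
Let M n w : R := (maximal_degree V B n w)%:R.

Lemma ln_order_to_infty :
  {ae P, forall w, forall K : R, \forall n \near \oo, K <= ln (N n w)}.
Proof.
apply: filterS (order_to_infty theta_gt0 theta_lt1 dd) => w H K.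
have := H (Num.truncn (expR K)).+1; apply: filterS => n Kn.
rewrite -ler_expR lnK; last by rewrite posrE ltr0n (leq_trans _ Kn).
by apply: le_trans (ltW (truncnS_gt _)) _; rewrite ler_nat.
Qed.

(** [s L] is the clique size claimed when [ln N = L]. The last hypothesis with [K = N0 * A] makes
    its barrier positive, so a clique of that size exists. *)
Lemma max_degree_lower (c : nat -> R) (m C : R) (s : R -> nat) :
  (forall s, 0 <= c s) -> (forall s, c s <= 1) ->
  0 < m -> m <= 1 -> 1 <= C ->
  (forall s, (1 < s)%N ->
    c s * (1 + (theta + m) / s%:R) <= theta * c s.-1 + (1 - theta) * c s.+1) ->
  (forall s N : nat, (0 < N)%N -> C * ln N%:R ^+ 2 < s%:R -> c s <= N%:R^-1) ->
  (forall L, (0 < s L)%N) ->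
  (forall K, exists L0 : R, forall L, L0 <= L -> K * L ^+ 7 < expR L * c (s L)) ->
  {ae P, forall w, \forall n \near \oo,
    (s (ln (N n w)) <= (maximal_degree V B n w).+1)%N}.
Proof.
move=> c0 c1 m0 m1 C1 crec csmall s0 cL.
have [A A0 AE] : exists2 A : R, 0 <= A & A = 1536 * (4 * C) ^+ 3 / m ^+ 2.
  exists (1536 * (4 * C) ^+ 3 / m ^+ 2) => [|]; last by [].
  apply: divr_ge0; last exact: sqr_ge0.
  apply: mulr_ge0; first exact: ler0n.
  apply: exprn_ge0; apply: mulr_ge0; first exact: ler0n.
  exact: le_trans C1.
have H :=
  size_count_lower theta_gt0 theta_lt1 dd c0 c1 m0 m1 C1 crec csmall A0 AE.
clear AE.
apply: filterS3 (order_to_infty theta_gt0 theta_lt1 dd) ln_order_to_infty H.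
move=> w ordw lnw [N0 N00 low].
have [L0 HL0] := cL (N0%:R * A); near=> n.
have Nn : (N0 <= order (graph_after V B n w))%N by near: n; exact: ordw.
have N1 : 0 < N n w by rewrite ltr0n (leq_trans N00).
have Ln : L0 <= ln (N n w) by near: n; exact: lnw.
have [|x <-] := @size_count_gt0 R (s (ln (N n w))) (graph_after V B n w).
  apply: lt_le_trans (low n _ Nn (s0 _)); rewrite subr_gt0.
  rewrite ltr_pdivlMr ?ltr0n// -/(N n w) mulrC mulrA.
  by have := HL0 _ Ln; rewrite lnK// posrE.
exact: clique_size_le_max.
Unshelve. all: by end_near. Qed.

Lemma clique_sum_ge_max (f : nat -> R) n w : (forall s, 0 <= f s) ->
  f (maximal_degree V B n w).+1 <= clique_sum f (graph_after V B n w).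
Proof.
move=> f0; have [cg g0] := graph_afterP V B n w.
have [x <-] := max_degree_attained g0; exact: clique_sum_ge.
Qed.

End Cases.

(** * The subcritical case *)

Section Subcritical.
Context (R : realType) (d : measure_display) (T : measurableType d)
        (P : probability T R).
Variables (theta : R) (V : nat -> {RV P >-> nat}) (B : nat -> {RV P >-> bool}).
Hypotheses (theta_gt0 : 0 < theta) (theta_lt2 : theta < 1 / 2).
Hypothesis dd : duplication_deletion theta V B.

Let N n w : R := (nb_vertices V B n w)%:R.
Let M n w : R := (maximal_degree V B n w)%:R.
Let gamma : R := dd_gamma theta.

Let theta_lt1 : theta < 1. Proof. have := theta_lt2; lra. Qed.

Let gammaE : theta * gamma = 1 - theta.
Proof. by rewrite /gamma /dd_gamma mulrC divfK// gt_eqF. Qed.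

Let gamma_gt1 : 1 < gamma.
Proof.
rewrite /gamma /dd_gamma ltr_pdivlMr// mul1r.
by have := theta_lt2; lra.
Qed.

Let gamma_gt0 : 0 < gamma. Proof. exact: lt_trans gamma_gt1. Qed.

Let ln_gamma_gt0 : 0 < ln gamma. Proof. exact: ln_gt0. Qed.

(** Since [theta * gamma ^ 2 - gamma + 1 - theta = 0], the powers of [gamma] are harmonic for the
    size of the selected clique; hence [lambda = 0], with [q = 2]. *)
Lemma subcritical_upper : {ae P, forall w, \forall n \near \oo,
  M n w / ln (N n w) <= (1 + theta) / (theta * ln gamma)}.
Proof.
pose f (s : nat) : R := if s is 0 then 0 else gamma ^+ s.
have fS s : f s.+1 = gamma ^+ s.+1 by [].
have f0 s : 0 <= f s by case: s => // s; rewrite exprn_ge0// ltW.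
have fh : {homo f : s t / (s <= t)%N >-> s <= t}.
  move=> s t; case: s => [_|s]; first exact: f0.
  case: t => // t st.
  by rewrite ler_weXn2l// ltW.
have C0 : 0 <= theta * gamma ^+ 2 by rewrite mulr_ge0 ?sqr_ge0// ltW.
have := @clique_sum_upper _ _ _ P _ _ _ theta_gt0 theta_lt1 dd f 0
  (theta * gamma ^+ 2) 2 f0 erefl fh isT (lexx _) _ C0.
case=> [||A [mA A0 HA]].
- by rewrite mulr_gt0.
(* At [s = 1], where harmonicity fails because [f 0 = 0], the constant [C] takes over. *)
- case=> // -[_|s _]; rewrite mul0r add0r [f _.+1]/= ?[f _.-1]/=.
    by rewrite mulr0 addr0 !mul1r mulr1 gerBl; exact: (f0 1%N).
  have -> : theta * gamma ^+ s.+3 + (1 - theta) * gamma ^+ s.+1 - f s.+2 = 0.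
    rewrite fS -gammaE !exprS.
    have : gamma * (theta * gamma - 1 + theta) = 0 by rewrite gammaE; ring.
    by move=> /(congr1 (fun x => x * gamma ^+ s.+1)); rewrite mul0r exprS => <-; ring.
  by rewrite mulr0 mulr_ge0.
have {mA A0}HA' : {ae P, forall w, exists K : R, \forall n \near \oo,
  clique_sum f (graph_after V B n w) <= K * N n w ^+ 2} by exists A.
apply: filterS2 (ln_order_to_infty theta_gt0 theta_lt1 dd) HA'.
move=> w lnw [K HK]; near=> n.
have L1 : 1 <= ln (N n w) by near: n; exact: lnw.
have LK : ln K <= ln (N n w) by near: n; exact: lnw.
have N0 : 0 < N n w.
  by rewrite ltNge; apply/negP => /ln0 Ln; move: L1; rewrite Ln ler10.
have SK : gamma ^+ (maximal_degree V B n w).+1 <= K * N n w ^+ 2.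
  by apply: (le_trans (clique_sum_ge_max V B n w f0)); near: n.
have K0 : 0 < K.
  have : 0 < K * N n w ^+ 2 by apply: lt_le_trans SK; rewrite exprn_gt0.
  by rewrite pmulr_lgt0// exprn_gt0.
have {}SK : (M n w + 1) * ln gamma <= ln K + 2 * ln (N n w).
  rewrite [M n w + 1]natr1 mulr_natl -lnXn// [2 * _]mulr_natl -lnXn//.
  rewrite -lnM ?posrE ?exprn_gt0// ler_ln ?posrE ?exprn_gt0//.
  by rewrite mulr_gt0// exprn_gt0.
rewrite invfM mulrA ler_pdivrMr ?(lt_le_trans _ L1)//.
rewrite mulrAC ler_pdivlMr//.
(* Two logarithms come from [q = 2], a third absorbs [ln K], and [3 <= (1 + theta) / theta] because
   [theta < 1 / 2]. *)
apply: (@le_trans _ _ (3 * ln (N n w))).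
  have : 0 < ln gamma by [].
  by move: SK LK; rewrite mulrDl; lra.
rewrite ler_wpM2r ?(le_trans _ L1)// ler_pdivlMr//.
by have := theta_lt2; lra.
Unshelve. all: by end_near. Qed.

Lemma subcritical_lower : {ae P, forall w, \forall n \near \oo,
  (1 - theta) / ln gamma <= M n w / ln (N n w)}.
Proof.
pose nu := 1 - 2 * theta.
have nu0 : 0 < nu by rewrite /nu; have := theta_lt2; lra.
(* The powers of [gamma] alone solve the recursion without the term in [1 / s]; the factor [s ^- p]
   gains [p * nu / s], and [p * nu >= 2 >= theta + 1] leaves the margin [m = 1]. *)
pose p := (Num.truncn (2 / nu)).+1.
have p2 : 2 <= p%:R * nu.
  by rewrite -ler_pdivrMr// ltW// truncnS_gt.
pose c (s : nat) : R := gamma ^- s * s%:R ^- p.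
pose t := ln gamma.
have c0 s : 0 <= c s by rewrite mulr_ge0 ?invr_ge0 ?exprn_ge0// ltW.
have gV s : gamma ^- s <= 1.
  by rewrite invf_le1 ?exprn_gt0// exprn_ege1// ltW.
have sV (s : nat) : s%:R ^- p <= 1 :> R.
  case: s => [|s]; first by rewrite expr0n invr0 ler01.
  by rewrite invf_le1 ?exprn_gt0// exprn_ege1// ler1n.
have c1 s : c s <= 1.
  by rewrite mulr_ile1// invr_ge0 exprn_ge0// ltW.
have crec (s : nat) : (1 < s)%N -> c s * (1 + (theta + 1) / s%:R) <=
    theta * c s.-1 + (1 - theta) * c s.+1.
  case: s => [|[|s]]// _; rewrite [_.+2.-1]/=; set k := s.+1.
  have k0 : 0 < k%:R :> R by rewrite ltr0n.
  have k1 : 0 < k.+1%:R :> R by rewrite ltr0n.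
  have k2 : 0 < k.+2%:R :> R by rewrite ltr0n.
  have h1 : 1 + p%:R / k.+1%:R <= (k.+1%:R / k%:R) ^+ p :> R.
    apply: (@le_trans _ _ (1 + p%:R * k%:R^-1)).
      by rewrite lerD2l ler_wpM2l// lef_pV2 ?posrE// ler_nat.
    have -> : k.+1%:R / k%:R = 1 + k%:R^-1 :> R.
      by rewrite -natr1 mulrDl divff ?gt_eqF// mul1r.
    by apply: exprDn_ge1; rewrite (@le_trans _ _ 0)// ?lerN10 ?invr_ge0.
  have h2 : 1 - p%:R / k.+1%:R <= (k.+1%:R / k.+2%:R) ^+ p :> R.
    apply: (@le_trans _ _ (1 + p%:R * - k.+2%:R^-1)).
      by rewrite mulrN lerD2l lerN2 ler_wpM2l// lef_pV2 ?posrE// ler_nat.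
    have -> : k.+1%:R / k.+2%:R = 1 + - k.+2%:R^-1 :> R.
      have -> : k.+1%:R = k.+2%:R - 1 :> R by rewrite -[k.+2%:R]natr1 addrK.
      by rewrite mulrBl mul1r divff// gt_eqF.
    by apply: exprDn_ge1; rewrite lerN2 invf_le1// ler1n.
  have e1 : theta * c k = gamma ^- k.+1 * k.+1%:R ^- p *
      ((1 - theta) * (k.+1%:R / k%:R) ^+ p).
    rewrite /c -gammaE [gamma ^+ k.+1]exprS [(k.+1%:R / _) ^+ p]expr_div_n.
    have : gamma ^+ k != 0 by rewrite expf_neq0 ?gt_eqF.
    have : gamma != 0 by rewrite gt_eqF.
    have : k%:R ^+ p != 0 :> R by rewrite expf_neq0 ?gt_eqF.
    have : k.+1%:R ^+ p != 0 :> R by rewrite expf_neq0 ?gt_eqF.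
    move: (k.+1%:R ^+ p) (k%:R ^+ p) (gamma ^+ k) => X Y Z X0 Y0 g0 Z0.
    by field; rewrite X0 Y0 g0 Z0.
  have e2 : (1 - theta) * c k.+2 = gamma ^- k.+1 * k.+1%:R ^- p *
      (theta * (k.+1%:R / k.+2%:R) ^+ p).
    rewrite /c -gammaE [gamma ^+ k.+2]exprS [(k.+1%:R / _) ^+ p]expr_div_n.
    have : gamma ^+ k.+1 != 0 by rewrite expf_neq0 ?gt_eqF.
    have : gamma != 0 by rewrite gt_eqF.
    have : k.+2%:R ^+ p != 0 :> R by rewrite expf_neq0 ?gt_eqF.
    have : k.+1%:R ^+ p != 0 :> R by rewrite expf_neq0 ?gt_eqF.
    move: (k.+1%:R ^+ p) (k.+2%:R ^+ p) (gamma ^+ k.+1) => X Y Z X0 Y0 g0 Z0.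
    by field; rewrite X0 Y0 g0 Z0.
  rewrite e1 e2 -mulrDr ler_wpM2l//.
  have t' : 0 <= 1 - theta by rewrite subr_ge0 ltW.
  have := ler_wpM2l t' h1; have := ler_wpM2l (ltW theta_gt0) h2.
  have : (theta + 1) / k.+1%:R <= 2 / k.+1%:R.
    rewrite ler_wpM2r ?invr_ge0// ?ltW//.
    by have := theta_lt1; lra.
  have : 2 / k.+1%:R <= p%:R * nu / k.+1%:R by rewrite ler_pM2r ?invr_gt0.
  rewrite /nu; move: (_ ^+ p) (_ ^+ p) => X Y.
  by move: (p%:R) (k.+1%:R^-1 : R) => a b; lra.
(* From [s >= ln n ^ 2 / t ^ 2] and [s <= s ^ 2] follows [s * t >= ln n], that is
   [gamma ^- s <= 1 / n]. *)
pose C := 1 + t ^- 2.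
have C1 : 1 <= C by rewrite lerDl invr_ge0 sqr_ge0.
have csmall (s n : nat) : (0 < n)%N -> C * ln n%:R ^+ 2 < s%:R ->
    c s <= n%:R^-1.
  move=> n0 Cs; apply: (@le_trans _ _ (gamma ^- s)).
    by rewrite ler_piMr// invr_ge0 exprn_ge0// ltW.
  rewrite lef_pV2 ?posrE ?exprn_gt0 ?ltr0n//.
  rewrite -ler_ln ?posrE ?exprn_gt0 ?ltr0n// lnXn//.
  rewrite -[X in _ <= X]mulr_natl -/t.
  have s0 : (0 < s)%N.
    rewrite -(ltr0n R); apply: le_lt_trans Cs.
    by rewrite mulr_ge0 ?sqr_ge0// (le_trans _ C1).
  have l0 : 0 <= ln n%:R :> R by rewrite ln_ge0// ler1n.
  rewrite -(@ler_pXn2r _ 2) ?nnegrE ?mulr_ge0 ?(ltW ln_gamma_gt0)//.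
  have ss : s%:R <= s%:R ^+ 2 :> R by rewrite -[X in X <= _]expr1 ler_weXn2l// ler1n.
  have Cl : ln n%:R ^+ 2 / t ^+ 2 <= s%:R.
    apply: le_trans (ltW Cs); rewrite /C mulrDl mul1r [_ ^- 2 * _]mulrC.
    by rewrite lerDr sqr_ge0.
  by rewrite exprMn -ler_pdivrMr ?exprn_gt0//; exact: le_trans ss.
pose y (L : R) := (1 - theta) * L / t.
(* One unit is for the truncation, the other because the degree is the clique size minus one. *)
pose s L := (Num.truncn (y L)).+2.
have y0 L : 0 <= L -> 0 <= y L.
  by move=> L0; rewrite divr_ge0 ?(ltW ln_gamma_gt0)// mulr_ge0// subr_ge0 ltW.
have := max_degree_lower theta_gt0 theta_lt1 dd c0 c1 ltr01 (lexx _) C1 crec csmall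
  (s := s) (fun _ => isT).
case=> [K|A [mA A0 HA]].
  (* [s L] is at most [D * L], and [gamma ^ (s L)] is of order [expR ((1 - theta) * L)]; this leaves
     [expR (theta * L)] against a power of [L]. *)
  pose D := 2 + t^-1.
  have D0 : 0 < D by rewrite addr_gt0// invr_gt0.
  have [L0 L01 HL] := @expR_gt_monomial R theta (`|K| * gamma ^+ 2 * D ^+ p) (7 + p)
    theta_gt0.
  exists L0 => L L0L; have L1 : 1 <= L by exact: le_trans L0L.
  have L_gt0 : 0 < L by exact: lt_le_trans L1.
  have sL : (s L)%:R <= y L + 2.
    rewrite /s -addn2 natrD lerD2r truncn_le; exact: y0 (ltW L_gt0).
  have sD : (s L)%:R <= D * L.
    apply: le_trans sL _; rewrite /D.
    have -> : y L = (1 - theta) / t * L by rewrite /y mulrAC.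
    have : (1 - theta) / t * L <= t^-1 * L.
      rewrite ler_pM2r// ler_piMl ?invr_ge0 ?(ltW ln_gamma_gt0)//.
      by rewrite gerBl ltW.
    by lra.
  have s0 : 0 < (s L)%:R :> R by rewrite ltr0n.
  have gs : gamma ^+ s L <= gamma ^+ 2 * expR ((1 - theta) * L).
    rewrite -[X in X ^+ s L](lnK gamma_gt0) -expRM_natl -/t.
    rewrite -[X in X ^+ 2](lnK gamma_gt0) -expRM_natl -/t -expRD ler_expR.
    apply: (@le_trans _ _ ((y L + 2) * t)); first by rewrite ler_pM2r.
    by rewrite mulrDl /y divfK ?gt_eqF// addrC.
  rewrite /c [expR L * _]mulrA ltr_pdivlMr ?exprn_gt0// ltr_pdivlMr ?exprn_gt0//.
  apply: (@le_lt_trans _ _ (`|K| * L ^+ 7 * (D * L) ^+ p * gamma ^+ s L)).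
    rewrite ler_pM2r ?exprn_gt0//.
    apply: (@le_trans _ _ (`|K| * L ^+ 7 * (s L)%:R ^+ p)).
      rewrite ler_pM2r ?exprn_gt0// ler_wpM2r ?ler_norm// exprn_ge0// ltW//.
    rewrite ler_wpM2l//.
      by rewrite mulr_ge0// exprn_ge0// ltW.
    by rewrite ler_pXn2r// nnegrE// mulr_ge0// ltW.
  have KL0 : 0 <= `|K| * L ^+ 7 * (D * L) ^+ p.
    by rewrite !mulr_ge0// ?exprn_ge0 ?mulr_ge0// ltW.
  apply: le_lt_trans (ler_wpM2l KL0 gs) _.
  have -> : expR L = expR (theta * L) * expR ((1 - theta) * L).
    by rewrite -expRD -mulrDl addrC subrK mul1r.
  rewrite [X in X < _]mulrA ltr_pM2r ?expR_gt0//.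
  suff -> : `|K| * L ^+ 7 * (D * L) ^+ p * gamma ^+ 2 =
      `|K| * gamma ^+ 2 * D ^+ p * L ^+ (7 + p) by exact: HL.
  rewrite [(D * L) ^+ p]exprMn [L ^+ (7 + p)]exprD.
  by move: (D ^+ p) (L ^+ p) (L ^+ 7) (gamma ^+ 2) => a b e h; ring.
have {mA A0}HA' : {ae P, forall w, \forall n \near \oo,
  (s (ln (N n w)) <= (maximal_degree V B n w).+1)%N} by exists A.
apply: filterS2 (ln_order_to_infty theta_gt0 theta_lt1 dd) HA'.
move=> w lnw HM; near=> n.
have L1 : 1 <= ln (N n w) by near: n; exact: lnw.
have L0 : 0 < ln (N n w) by exact: lt_le_trans L1.
have Ms : (s (ln (N n w)) <= (maximal_degree V B n w).+1)%N by near: n.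
rewrite ler_pdivlMr// mulrAC -/t -/(y _).
apply: le_trans (ltW (truncnS_gt _)) _.
by rewrite ler_nat -ltnS.
Unshelve. all: by end_near. Qed.

End Subcritical.

(** * The critical case *)

Section SquareRoot.
Variable R : realType.
Implicit Type s : nat.

Lemma sqrtrS_le s : (0 < s)%N ->
  Num.sqrt s.+1%:R <= Num.sqrt s%:R + (2 * Num.sqrt s%:R)^-1 :> R.
Proof.
move=> s0; have r0 : 0 < Num.sqrt s%:R :> R by rewrite sqrtr_gt0 ltr0n.
have rE : Num.sqrt s%:R ^+ 2 = s%:R :> R by rewrite sqr_sqrtr.
move: (Num.sqrt s%:R) r0 rE => r r0 rE.
have y0 : 0 <= r + (2 * r)^-1 by rewrite addr_ge0 ?invr_ge0 ?mulr_ge0// ltW.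
rewrite -(@ler_pXn2r _ 2) ?nnegrE ?sqrtr_ge0// sqr_sqrtr// -natr1 -rE.
have -> : (r + (2 * r)^-1) ^+ 2 = r ^+ 2 + 1 + ((2 * r)^-1) ^+ 2.
  by field; rewrite gt_eqF.
by rewrite lerDl sqr_ge0.
Qed.

Lemma sqrtr_pred_le s : (0 < s)%N ->
  Num.sqrt s.-1%:R <= Num.sqrt s%:R - (2 * Num.sqrt s%:R)^-1 :> R.
Proof.
case: s => // s _; have r1 : 1 <= Num.sqrt s.+1%:R :> R.
  by rewrite -[X in X <= _]sqrtr1 ler_sqrt// ler1n.
have rE : Num.sqrt s.+1%:R ^+ 2 = s%:R + 1 :> R by rewrite sqr_sqrtr// natr1.
rewrite [s.+1.-1]/=; move: (Num.sqrt s.+1%:R) r1 rE => r r1 rE.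
have r0 : 0 < r by lra.
have y0 : 0 <= r - (2 * r)^-1.
  rewrite subr_ge0 -[X in X <= _]mul1r ler_pdivrMr ?mulr_gt0//.
  have : r * 1 <= r * r by rewrite ler_pM2l.
  by lra.
rewrite -(@ler_pXn2r _ 2) ?nnegrE ?sqrtr_ge0// sqr_sqrtr//.
have -> : (r - (2 * r)^-1) ^+ 2 = r ^+ 2 - 1 + ((2 * r)^-1) ^+ 2.
  by field; rewrite gt_eqF.
by rewrite rE addrK lerDl sqr_ge0.
Qed.

(** To be used with [x = 3 / (4 * sqrt s)]. Halving the argument brings it into the range of
    [expR_le_quadratic]. *)
Lemma cosh_upper (x : R) : 0 <= x -> x <= 3 / 4 ->
  expR x + expR (- x) <= 2 + 14 / 5 * x ^+ 2.
Proof.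
move=> x0 x1; have x2 : 0 <= x / 2 by lra.
have x3 : x / 2 <= 2^-1 by lra.
have h1 := expR_le_quadratic x2 x3; have h2 := expRN_le_quadratic x0.
have -> : expR x = expR (x / 2) ^+ 2.
  by rewrite -expRM_natl; congr expR; field.
have h3 : expR (x / 2) ^+ 2 <= (1 + x / 2 + 2 * (x / 2) ^+ 2) ^+ 2.
  by rewrite ler_pXn2r// nnegrE ?expR_ge0// (le_trans _ h1)// expR_ge0.
have h4 : (1 + x / 2 + 2 * (x / 2) ^+ 2) ^+ 2 =
    1 + x + 5 / 4 * x ^+ 2 + x ^+ 2 * (x / 2) + x ^+ 2 * (x ^+ 2 / 4) by field.
have h5 : x ^+ 2 * (x / 2) <= x ^+ 2 * (3 / 8).
  by rewrite ler_wpM2l ?sqr_ge0//; lra.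
have h6 : x ^+ 2 <= 9 / 16 by rewrite expr2; nra.
have h7 : x ^+ 2 * (x ^+ 2 / 4) <= x ^+ 2 * (9 / 64).
  by rewrite ler_wpM2l ?sqr_ge0//; lra.
have : 0 <= x ^+ 2 by rewrite sqr_ge0.
lra.
Qed.

(** To be used with [x = 3 / (2 * sqrt s)]. The left-over above 2 is the square of
    [expR (x / 2) - expR (- (x / 2))], for which a linear lower bound is enough. *)
Lemma cosh_lower (x : R) : 0 <= x -> x <= 4 / 3 ->
  2 + 16 / 25 * x ^+ 2 <= expR x + expR (- x).
Proof.
move=> x0 x1; pose u := x / 2; have u0 : 0 <= u by rewrite /u; lra.
have e1 : 1 + u <= expR u by exact: expR_ge1Dx.
have e2 : expR (- u) <= (1 + u)^-1.
  by rewrite expRN lef_pV2 ?posrE ?expR_gt0//; lra.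
have h : 8 / 5 * u <= expR u - expR (- u).
  apply: (@le_trans _ _ (1 + u - (1 + u)^-1)); last lra.
  have -> : 1 + u - (1 + u)^-1 = u * ((2 + u) / (1 + u)).
    by field; rewrite gt_eqF//; lra.
  rewrite mulrC ler_wpM2l// ler_pdivlMr ?ltr_pwDl//.
  by rewrite /u; lra.
have -> : expR x + expR (- x) = (expR u - expR (- u)) ^+ 2 + 2.
  have -> : (expR u - expR (- u)) ^+ 2 + 2 =
      expR u ^+ 2 + expR (- u) ^+ 2 + 2 * (1 - expR u * expR (- u)) by ring.
  rewrite -expRD subrr expR0 subrr mulr0 addr0 -!expRM_natl.
  by congr (expR _ + expR _); rewrite /u; field.
have : (8 / 5 * u) ^+ 2 <= (expR u - expR (- u)) ^+ 2.
  have u8 : 0 <= 8 / 5 * u by lra.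
  by rewrite ler_pXn2r// nnegrE// (le_trans u8).
by rewrite /u; lra.
Qed.

End SquareRoot.

Section Critical.
Context (R : realType) (d : measure_display) (T : measurableType d)
        (P : probability T R).
Variables (theta : R) (V : nat -> {RV P >-> nat}) (B : nat -> {RV P >-> bool}).
Hypothesis thetaE : theta = 1 / 2.
Hypothesis dd : duplication_deletion theta V B.

Let N n w : R := (nb_vertices V B n w)%:R.
Let M n w : R := (maximal_degree V B n w)%:R.

Let theta_gt0 : 0 < theta. Proof. by rewrite thetaE; lra. Qed.
Let theta_lt1 : theta < 1. Proof. by rewrite thetaE; lra. Qed.

(** A step changes [3 / 2 * sqrt s] by about [x = 3 / (4 * sqrt s)], so the drift is at most
    [s * (7 / 5 * x ^ 2) = 63 / 80] times [f s], below [lambda = 4 / 5 < theta * 2]. *)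
Lemma critical_upper : {ae P, forall w, \forall n \near \oo,
  M n w / ln (N n w) ^+ 2 <= 9 / 4}.
Proof.
pose f (s : nat) : R := if s is 0 then 0 else expR (3 / 2 * Num.sqrt s%:R).
have fle s : f s <= expR (3 / 2 * Num.sqrt s%:R).
  by case: s => // *; exact: expR_ge0.
have f0 s : 0 <= f s by case: s => // s; exact: expR_ge0.
have fh : {homo f : s t / (s <= t)%N >-> s <= t}.
  move=> s t; case: s => [_|s]; first exact: f0.
  case: t => // t st; rewrite ler_expR ler_pM2l; last lra.
  by rewrite ler_sqrt// ler_nat.
have l0 : 0 <= 4 / 5 :> R by lra.
have lq : 4 / 5 < theta * 2%:R by rewrite thetaE; lra.
have := @clique_sum_upper _ _ _ P _ _ _ theta_gt0 theta_lt1 dd f (4 / 5) 0 2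
  f0 erefl fh isT l0 lq (lexx _).
case=> [s s0|A [mA A0 HA]].
  have sR1 : 1 <= s%:R :> R by rewrite ler1n.
  have fE : f s = expR (3 / 2 * Num.sqrt s%:R) by case: s s0 {sR1}.
  rewrite mul0r addr0.
  set r := Num.sqrt s%:R in fE; have r1 : 1 <= r.
    by rewrite -[X in X <= _]sqrtr1 ler_sqrt// ler1n.
  have r0 : 0 < r by lra.
  have rE : r ^+ 2 = s%:R by rewrite sqr_sqrtr.
  pose x := 3 / 2 * (2 * r)^-1.
  have xE : x = 3 / 4 / r by rewrite /x; field; rewrite gt_eqF.
  have x0 : 0 <= x by rewrite xE divr_ge0//; lra.
  have x1 : x <= 3 / 4 by rewrite xE ler_pdivrMr// ler_peMr//; lra.
  have fp : f s.+1 <= f s * expR x.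
    rewrite fE -expRD ler_expR /x -mulrDr ler_pM2l; last lra.
    exact: sqrtrS_le.
  have fm : f s.-1 <= f s * expR (- x).
    apply: le_trans (fle _) _.
    rewrite fE -expRD ler_expR /x -mulrN -mulrDr ler_pM2l; last lra.
    exact: sqrtr_pred_le.
  have ch := ler_wpM2l (f0 s) (cosh_upper x0 x1).
  have main : theta * f s.+1 + (1 - theta) * f s.-1 - f s <=
      f s * (7 / 5 * x ^+ 2) by rewrite thetaE; lra.
  apply: (@le_trans _ _ (s%:R * (f s * (7 / 5 * x ^+ 2)))).
    by rewrite ler_wpM2l.
  have -> : s%:R * (f s * (7 / 5 * x ^+ 2)) = f s * (63 / 80).
    by rewrite -rE xE; field; rewrite gt_eqF.
  by have := f0 s; lra.
have {mA A0}HA' : {ae P, forall w, exists K : R, \forall n \near \oo,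
  clique_sum f (graph_after V B n w) <= K * N n w ^+ 2} by exists A.
apply: filterS2 (ln_order_to_infty theta_gt0 theta_lt1 dd) HA'.
move=> w lnw [K HK]; near=> n.
have L1 : 1 <= ln (N n w) by near: n; exact: lnw.
have LK : 4 * ln K <= ln (N n w) by near: n; exact: lnw.
have N0 : 0 < N n w.
  by rewrite ltNge; apply/negP => /ln0 Ln; move: L1; rewrite Ln ler10.
have SK : expR (3 / 2 * Num.sqrt (maximal_degree V B n w).+1%:R) <= K * N n w ^+ 2.
  by apply: (le_trans (clique_sum_ge_max V B n w f0)); near: n.
have K0 : 0 < K.
  have : 0 < K * N n w ^+ 2 by apply: lt_le_trans SK; rewrite expR_gt0.
  by rewrite pmulr_lgt0// exprn_gt0.
have {}SK : 3 / 2 * Num.sqrt (maximal_degree V B n w).+1%:R <=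
    ln K + 2 * ln (N n w).
  rewrite [2 * _]mulr_natl -lnXn// -lnM ?posrE ?exprn_gt0//.
  by rewrite -ler_expR lnK// posrE mulr_gt0// exprn_gt0.
rewrite ler_pdivrMr ?exprn_gt0 ?(lt_le_trans _ L1)//.
set D := (maximal_degree V B n w).+1%:R in SK.
apply: (@le_trans _ _ D); first by rewrite ler_nat.
(* As [4 * ln K <= ln N], the bound in [SK] is at most [9 / 4 * ln N]. *)
have sD : Num.sqrt D <= 3 / 2 * ln (N n w) by lra.
have -> : D = Num.sqrt D ^+ 2 by rewrite sqr_sqrtr.
have -> : 9 / 4 * ln (N n w) ^+ 2 = (3 / 2 * ln (N n w)) ^+ 2 by field.
rewrite ler_pXn2r// nnegrE ?sqrtr_ge0// (le_trans _ sD)// sqrtr_ge0//.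
Unshelve. all: by end_near. Qed.

(** The relative gain of [expR (- (3 * sqrt s))] in the recursion is at least [18 / 25 / s], just
    above [theta + m = 7 / 10]. For [s] near [(L / 4) ^ 2], the product [expR L * c s] is of order
    [expR (L / 4)] and beats every power of [L]. *)
Lemma critical_lower : {ae P, forall w, \forall n \near \oo,
  1 / 16 <= M n w / ln (N n w) ^+ 2}.
Proof.
pose c (s : nat) : R := expR (- (3 * Num.sqrt s%:R)).
have c0 s : 0 <= c s by exact: expR_ge0.
have c1 s : c s <= 1.
  by rewrite -[X in _ <= X]expR0 ler_expR oppr_le0 mulr_ge0// sqrtr_ge0.
have m0 : 0 < 5^-1 :> R by rewrite invr_gt0.
have m1 : 5^-1 <= 1 :> R by rewrite invf_le1// ler1n.
have crec (s : nat) : (1 < s)%N -> c s * (1 + (theta + 5^-1) / s%:R) <=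
    theta * c s.-1 + (1 - theta) * c s.+1.
  move=> s2; have s0 : (0 < s)%N by exact: ltnW.
  have sR2 : 2 <= s%:R :> R by rewrite ler_nat.
  set r : R := Num.sqrt s%:R.
  have rE : r ^+ 2 = s%:R by rewrite sqr_sqrtr.
  have r0 : 0 < r by rewrite sqrtr_gt0 ltr0n.
  (* This uses [s >= 2] and brings [x] into the range of [cosh_lower]. *)
  have r98 : 9 / 8 <= r.
    have h : (9 / 8) ^+ 2 <= r ^+ 2 by rewrite rE; lra.
    by rewrite -(@ler_pXn2r _ 2) ?nnegrE ?(ltW r0).
  pose x := 3 * (2 * r)^-1.
  have xE : x = 3 / 2 / r by rewrite /x; field; rewrite gt_eqF.
  have x0 : 0 <= x by rewrite xE divr_ge0 ?(ltW r0)//; lra.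
  have x1 : x <= 4 / 3 by rewrite xE ler_pdivrMr//; lra.
  have cp : c s * expR (- x) <= c s.+1.
    rewrite -expRD ler_expR /x -opprD -mulrDr lerN2 ler_pM2l//.
    exact: sqrtrS_le.
  have cm : c s * expR x <= c s.-1.
    rewrite -expRD ler_expR /x; have := sqrtr_pred_le R s0; rewrite -/r.
    by move: (_^-1) => y; lra.
  have ch := ler_wpM2l (c0 s) (cosh_lower x0 x1).
  have xs : 8 / 25 * x ^+ 2 = (18 / 25) / s%:R.
    by rewrite -rE xE; field; rewrite gt_eqF.
  have : c s * (1 + (theta + 5^-1) / s%:R) <= c s * (1 + 8 / 25 * x ^+ 2).
    rewrite ler_wpM2l// lerD2l xs ler_wpM2r// thetaE; lra.
  by rewrite thetaE; lra.
have csmall (s n : nat) : (0 < n)%N -> 1 * ln n%:R ^+ 2 < s%:R :> R ->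
    c s <= n%:R^-1.
  move=> n0; rewrite mul1r => Cs.
  have l0 : 0 <= ln n%:R :> R by rewrite ln_ge0// ler1n.
  rewrite -[X in _ <= X^-1]lnK ?posrE ?ltr0n// -expRN ler_expR lerN2.
  have : ln n%:R <= Num.sqrt s%:R :> R.
    rewrite -(@ler_pXn2r _ 2) ?nnegrE ?sqrtr_ge0//.
    by rewrite [X in _ <= X]sqr_sqrtr//; exact: ltW.
  by have := sqrtr_ge0 (s%:R : R); lra.
pose s (L : R) := (Num.truncn (1 / 16 * L ^+ 2)).+2.
have := max_degree_lower theta_gt0 theta_lt1 dd c0 c1 m0 m1 (lexx _) crec csmall
  (s := s) (fun _ => isT).
case=> [K|A [mA A0 HA]].
  have a0 : 0 < 4^-1 :> R by rewrite invr_gt0.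
  have [L0 L01 HL] := @expR_gt_monomial R (4^-1) (K * expR 6) 7 a0.
  exists L0 => L L0L; have L1 : 1 <= L by exact: le_trans L0L.
  have sL : (s L)%:R <= (L / 4 + 2) ^+ 2.
    have : (Num.truncn (1 / 16 * L ^+ 2))%:R <= 1 / 16 * L ^+ 2.
      by rewrite truncn_le mulr_ge0 ?sqr_ge0//; lra.
    have -> : (s L)%:R = (Num.truncn (1 / 16 * L ^+ 2))%:R + 2 :> R.
      by rewrite /s -addn2 natrD.
    by move: (_%:R) => x; lra.
  have sq : Num.sqrt (s L)%:R <= L / 4 + 2.
    rewrite -(@ler_pXn2r _ 2) ?nnegrE ?sqrtr_ge0// ?sqr_sqrtr//.
    by lra.
  have : expR (- (3 * (L / 4 + 2))) <= c (s L).
    by rewrite ler_expR lerN2 ler_pM2l.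
  move=> /(ler_wpM2l (expR_ge0 L)); apply: lt_le_trans.
  have -> : expR L * expR (- (3 * (L / 4 + 2))) = expR (4^-1 * L) / expR 6.
    by rewrite -expRN -!expRD; congr expR; field.
  by rewrite ltr_pdivlMr ?expR_gt0// mulrAC; exact: HL.
have {mA A0}HA' : {ae P, forall w, \forall n \near \oo,
  (s (ln (N n w)) <= (maximal_degree V B n w).+1)%N} by exists A.
apply: filterS2 (ln_order_to_infty theta_gt0 theta_lt1 dd) HA'.
move=> w lnw HM; near=> n.
have L1 : 1 <= ln (N n w) by near: n; exact: lnw.
have L0 : 0 < ln (N n w) by exact: lt_le_trans L1.
have Ms : (s (ln (N n w)) <= (maximal_degree V B n w).+1)%N by near: n.
rewrite ler_pdivlMr ?exprn_gt0//.
apply: le_trans (ltW (truncnS_gt _)) _.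
by rewrite ler_nat -ltnS.
Unshelve. all: by end_near. Qed.

End Critical.

(** * The supercritical case *)

Section Supercritical.
Context (R : realType) (d : measure_display) (T : measurableType d)
        (P : probability T R).
Variables (theta : R) (V : nat -> {RV P >-> nat}) (B : nat -> {RV P >-> bool}).
Hypotheses (theta_gt2 : 1 / 2 < theta) (theta_lt1 : theta < 1).
Hypothesis dd : duplication_deletion theta V B.

Let N n w : R := (nb_vertices V B n w)%:R.
Let M n w : R := (maximal_degree V B n w)%:R.
Let beta : R := dd_beta theta.

Let theta_gt0 : 0 < theta. Proof. have := theta_gt2; lra. Qed.
Let theta'_ge0 : 0 <= 1 - theta. Proof. by rewrite subr_ge0 ltW. Qed.

Let betaV : beta^-1 = (2 * theta - 1) / theta.
Proof. by rewrite /beta /dd_beta invf_div. Qed.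

Let betaV_gt0 : 0 < beta^-1.
Proof. by rewrite betaV divr_gt0//; have := theta_gt2; lra. Qed.

(** The drift of [rising_bin p] is [(2 * theta - 1) * (p + 1)] times itself, up to an error of lower
    order from the backward difference; [lambda] lies halfway between this rate and [theta * q]. *)
Lemma supercritical_upper_degree (p q : nat) : (1 < q)%N ->
  (2 * theta - 1) * p.+1%:R < theta * q%:R ->
  {ae P, forall w, exists K : R, \forall n \near \oo,
    (M n w + 1) ^+ p.+1 <= K * N n w ^+ q}.
Proof.
move=> q1 pq; pose f := @rising_bin R p.
pose lambda := ((2 * theta - 1) * p.+1%:R + theta * q%:R) / 2.
pose e := lambda - (2 * theta - 1) * p.+1%:R.
have e0 : 0 < e by rewrite /e /lambda; lra.
have lq : lambda < theta * q%:R by rewrite /lambda; lra.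
have p0 : 0 < p.+1%:R :> R by rewrite ltr0n.
have l0 : 0 <= lambda.
  have : 0 <= (2 * theta - 1) * p.+1%:R.
    by rewrite mulr_ge0//; have := theta_gt2; lra.
  by move: e0; rewrite /e; lra.
(* Beyond [s0] the error is at most [e * f s], up to [s0] at most the constant [C]. *)
pose s0 := (Num.truncn (p%:R * p.+1%:R / e)).+1.
pose C := p%:R * p.+1%:R * f s0.
have C0 : 0 <= C by rewrite !mulr_ge0.
have H := @clique_sum_upper _ _ _ P _ _ _ theta_gt0 theta_lt1 dd f lambda C q
  (fun _ => rising_bin_ge0 _ _) (rising_bin0 _) (rising_bin_homo p) q1 l0 lq C0.
suff fstep (s : nat) : (0 < s)%N ->
    s%:R * (theta * f s.+1 + (1 - theta) * f s.-1 - f s) <=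
    lambda * f s + C * s%:R.
  apply: filterS (H fstep) => w [K HK]; exists ((p.+1)`!%:R * K); near=> n.
  rewrite natr1; apply: le_trans (rising_bin_lower p _) _.
  rewrite -mulrA ler_wpM2l//.
  apply: (le_trans (clique_sum_ge_max V B n w _)); last by near: n.
  by move=> s; exact: rising_bin_ge0.
move=> spos; have sR : 0 < s%:R :> R by rewrite ltr0n.
have uE := rising_binS (R := R) p s.
have yE := rising_bin_pred (R := R) p spos.
rewrite -/f in uE yE.
have sp : 0 < (s + p)%:R :> R by rewrite ltr0n addn_gt0 spos.
have fs0 : 0 <= f s by exact: rising_bin_ge0.
pose h := p%:R * (p.+1%:R * f s / (s + p)%:R).
have yE' : s%:R * (f s - f s.-1) = p.+1%:R * f s - h.
  rewrite /h -yE mulrAC divff ?gt_eqF// mul1r natrD; ring.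
have -> : s%:R * (theta * f s.+1 + (1 - theta) * f s.-1 - f s) =
    (2 * theta - 1) * p.+1%:R * f s + (1 - theta) * h.
  have -> : s%:R * (theta * f s.+1 + (1 - theta) * f s.-1 - f s) =
    theta * (s%:R * (f s.+1 - f s)) - (1 - theta) * (s%:R * (f s - f s.-1)).
    by ring.
  by rewrite uE yE'; ring.
have h0 : 0 <= h by rewrite mulr_ge0// divr_ge0// mulr_ge0.
have h1 : (1 - theta) * h <= h.
  by rewrite ler_piMl// gerBl ltW.
suff : h <= e * f s + C * s%:R by rewrite /e; lra.
have hE : h = p%:R * p.+1%:R / (s + p)%:R * f s by rewrite /h; ring.
have [ss|ss] := leqP s s0.
  apply: (@le_trans _ _ C); last first.
    rewrite -[X in X <= _]add0r lerD ?mulr_ge0 ?(ltW e0)//.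
    by rewrite ler_peMr// ler1n.
  rewrite hE ler_pM ?divr_ge0 ?mulr_ge0 ?rising_bin_homo//.
  by rewrite ler_pdivrMr// ler_peMr ?mulr_ge0// ler1n addn_gt0 spos.
apply: (@le_trans _ _ (e * f s)); last by rewrite lerDl mulr_ge0// ltW.
rewrite hE ler_wpM2r// ler_pdivrMr// -ler_pdivrMl// [e^-1 * _]mulrC.
apply: le_trans (ltW (truncnS_gt _)) _.
by rewrite ler_nat (leq_trans (ltnW ss))// leq_addr.
Unshelve. all: by end_near. Qed.

(** Rounding [(k + 1) / beta] up to [q] costs at most 2 and [ln K <= ln N] one more, whence the
    3. *)
Lemma supercritical_upper (k : nat) : {ae P, forall w, \forall n \near \oo,
  ln (M n w) / ln (N n w) <= beta^-1 + 3 / k.+1%:R}.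
Proof.
pose q := (Num.truncn (k.+1%:R / beta)).+2.
have k0 : 0 < k.+1%:R :> R by rewrite ltr0n.
have kb0 : 0 <= k.+1%:R / beta by rewrite mulr_ge0// ltW.
have qk : k.+1%:R / beta < q%:R.
  by rewrite (lt_trans (truncnS_gt _))// ltr_nat.
have kq : q%:R <= k.+1%:R / beta + 2.
  by rewrite /q -addn2 natrD lerD2r truncn_le.
have pq : (2 * theta - 1) * k.+1%:R < theta * q%:R.
  by move: qk; rewrite betaV mulrA ltr_pdivrMr// mulrC [q%:R * _]mulrC.
apply: filterS2 (ln_order_to_infty theta_gt0 theta_lt1 dd)
  (supercritical_upper_degree (isT : 1 < q)%N pq).
move=> w lnw [K HK]; near=> n.
have L1 : 1 <= ln (N n w) by near: n; exact: lnw.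
have LK : ln K <= ln (N n w) by near: n; exact: lnw.
have L0 : 0 < ln (N n w) by exact: lt_le_trans L1.
have N0 : 0 < N n w.
  by rewrite ltNge; apply/negP => /ln0 Ln; move: L1; rewrite Ln ler10.
have MK : (M n w + 1) ^+ k.+1 <= K * N n w ^+ q by near: n.
have M0 : 0 < M n w + 1 by rewrite ltr_wpDl.
have K0 : 0 < K.
  have : 0 < K * N n w ^+ q by apply: lt_le_trans MK; rewrite exprn_gt0.
  by rewrite pmulr_lgt0// exprn_gt0.
(* If [M = 0], the left side is [ln 0 = 0]. *)
have lM : ln (M n w) <= ln (M n w + 1).
  have [M1|M1] := ltP 0 (M n w); first by rewrite ler_ln ?posrE// lerDl.
  by rewrite (ln0 M1) ln_ge0// lerDr.
have : k.+1%:R * ln (M n w + 1) <= ln K + q%:R * ln (N n w).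
  rewrite !mulr_natl -!lnXn// -lnM ?posrE ?exprn_gt0//.
  rewrite ler_ln ?posrE; [exact: MK|by rewrite exprn_gt0|].
  by rewrite mulr_gt0 ?exprn_gt0.
move=> H; rewrite ler_pdivrMr// (le_trans lM)// -(ler_pM2l k0) (le_trans H)//.
have -> : k.+1%:R * ((beta^-1 + 3 / k.+1%:R) * ln (N n w)) =
    (k.+1%:R / beta + 3) * ln (N n w).
  move: (beta^-1) (ln (N n w)) (k.+1%:R : R) k0 => a b e e0.
  by field; rewrite gt_eqF.
have := ler_wpM2r (ltW L0) kq; lra.
Unshelve. all: by end_near. Qed.

(** The target [theta / beta] is strictly below the growth rate [1 / beta], so a single large [p]
    makes room for all losses. *)
Lemma supercritical_lower : {ae P, forall w, \forall n \near \oo,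
  theta / beta <= ln (M n w) / ln (N n w)}.
Proof.
pose delta := (1 - theta) / beta.
have d0 : 0 < delta by rewrite mulr_gt0// subr_gt0.
pose p := Num.truncn (4 / delta).
pose x := p.+1%:R / beta.
have p0 : 0 < p.+1%:R :> R by rewrite ltr0n.
have x0 : 0 <= x by rewrite mulr_ge0// ltW.
(* Room of 4 suffices for the rounding of [x], the factor [N] in the bound [SM] and the constant
   [A]. *)
have pd : 4 < p.+1%:R * delta by rewrite -ltr_pdivrMr// truncnS_gt.
have x4 : theta * x + 4 < x.
  have -> : theta * x = x - p.+1%:R * delta by rewrite /x /delta; ring.
  by lra.
have [q qE] : exists q, Num.truncn x = q.+3.
  have : (3 <= Num.truncn x)%N.
    rewrite truncn_ge_nat//; have : 0 <= theta * x by rewrite mulr_ge0// ltW.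
    by lra.
  by case: Num.truncn => [|[|[|q]]]// _; exists q.
have qx : q%:R + 3 <= x.
  by rewrite -natrD addn3 -qE truncn_le.
have xq : x < q%:R + 4.
  by rewrite -natrD addn4 -qE truncnS_gt.
have pq : theta * q.+2%:R < (2 * theta - 1) * p.+1%:R.
  have -> : (2 * theta - 1) * p.+1%:R = theta * x.
    by rewrite /x betaV; field; rewrite gt_eqF.
  rewrite ltr_pM2l// (lt_le_trans _ qx)// -natrD ltr_nat addn3//.
apply: filterS2 (ln_order_to_infty theta_gt0 theta_lt1 dd)
  (@clique_sum_rising_lower _ _ _ P _ _ _ theta_gt0 theta_lt1 dd p q.+1 pq).
move=> w lnw [K HK]; near=> n.
pose A := (q.+2)`!%:R * K * p.+1%:R ^+ p.+1 * 2 ^+ p.+1.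
have L1 : 1 <= ln (N n w) by near: n; exact: lnw.
have LA : ln A <= ln (N n w) by near: n; exact: lnw.
have L0 : 0 < ln (N n w) by exact: lt_le_trans L1.
have N0 : 0 < N n w.
  by rewrite ltNge; apply/negP => /ln0 Ln; move: L1; rewrite Ln ler10.
have [cg g0] := graph_afterP V B n w.
have HS : rising_bin q.+1 (order (graph_after V B n w)) <=
  K * clique_sum (@rising_bin R p) (graph_after V B n w) by near: n.
have SM : clique_sum (@rising_bin R p) (graph_after V B n w) <=
    N n w * rising_bin p (maximal_degree V B n w).+1.
  apply: clique_sum_le => [v|]; last exact: rising_bin_ge0.
  by apply: rising_bin_homo; exact: clique_size_le_max.
(* [m] is positive and has the same logarithm as [M], as [ln 0 = ln 1 = 0]. *)
pose m := maxn (maximal_degree V B n w) 1.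
have m1 : 1 <= m%:R :> R by rewrite ler1n leq_maxr.
have lm : ln (M n w) = ln m%:R.
  rewrite /m /M; case: maximal_degree => [|j]; first by rewrite ln0// ln1.
  by rewrite (maxn_idPl _).
have fM : rising_bin p (maximal_degree V B n w).+1 <= (2 * p.+1%:R * m%:R) ^+ p.+1 :> R.
  apply: le_trans (rising_bin_upper _ _) _.
  rewrite ler_pXn2r ?nnegrE ?mulr_ge0// -!natrM ler_nat.
  have : (maximal_degree V B n w <= m)%N by rewrite leq_maxl.
  have : (0 < m)%N by rewrite leq_maxr.
  move: (maximal_degree V B n w) (m : nat) => a b b0 ab.
  by rewrite -mulnA mulnCA [(a.+1 + p)%N]addSn; move: b0 ab; clear; nia.
have S0 : 0 < clique_sum (@rising_bin R p) (graph_after V B n w).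
  have [v _] := max_degree_attained g0.
  apply: lt_le_trans (clique_sum_ge (f := @rising_bin R p) v cg _); last first.
    by move=> s; exact: rising_bin_ge0.
  by apply: lt_le_trans (rising_bin_geid _ _); rewrite ltr0n.
have W0 : 0 < rising_bin q.+1 (order (graph_after V B n w)) :> R.
  by apply: lt_le_trans (rising_bin_geid _ _); rewrite ltr0n.
have K0 : 0 < K.
  by have := lt_le_trans W0 HS; rewrite pmulr_lgt0.
have A0 : 0 < A.
  by rewrite !mulr_gt0 ?exprn_gt0// ltr0n fact_gt0.
have : N n w ^+ q.+2 <= N n w * (A * m%:R ^+ p.+1).
  apply: le_trans (rising_bin_lower q.+1 _) _.
  have -> : N n w * (A * m%:R ^+ p.+1) =
      (q.+2)`!%:R * (K * (N n w * (2 * p.+1%:R * m%:R) ^+ p.+1)).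
    by rewrite !exprMn /A; ring.
  rewrite ler_wpM2l// (le_trans HS)// ler_pM2l// (le_trans SM)//.
  by rewrite ler_pM2l.
rewrite exprS ler_pM2l// => H.
have m0 : 0 < m%:R :> R by exact: lt_le_trans m1.
have {}H : q.+1%:R * ln (N n w) <= ln A + p.+1%:R * ln m%:R.
  rewrite !mulr_natl -!lnXn// -lnM ?posrE ?exprn_gt0//.
  rewrite ler_ln ?posrE; [exact: H|by rewrite exprn_gt0|].
  by rewrite mulr_gt0 ?exprn_gt0.
rewrite ler_pdivlMr// lm -(ler_pM2l p0).
have -> : p.+1%:R * (theta / beta * ln (N n w)) = theta * x * ln (N n w).
  by rewrite /x; ring.
have : theta * x * ln (N n w) <= q%:R * ln (N n w).
  by rewrite ler_pM2r//; lra.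
rewrite -natr1 in H; lra.
Unshelve. all: by end_near. Qed.

End Supercritical.

(** * The three regimes *)

Theorem theorem4 (R : realType) (d : measure_display) (T : measurableType d)
    (P : probability T R) (theta : R)
    (V : nat -> {RV P >-> nat}) (B : nat -> {RV P >-> bool})
    (theta_gt0 : 0 < theta) (theta_lt1 : theta < 1)
    (dd : duplication_deletion theta V B) :
  let N n w : R := (nb_vertices V B n w)%:R in
  let M n w : R := (maximal_degree V B n w)%:R in
  let gamma := dd_gamma theta in
  let beta := dd_beta theta in
  [/\ theta < 1 / 2 ->
      {ae P, forall w,
        let u n := (M n w / ln (N n w))%:E in
        [/\ (((1 - theta) / ln gamma)%:E <= limn_einf u)%E,
            (limn_einf u <= limn_esup u)%E &
            (limn_esup u <= ((1 + theta) / (theta * ln gamma))%:E)%E]},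
      theta = 1 / 2 ->
      {ae P, forall w,
        let u n := (M n w / ln (N n w) ^+ 2)%:E in
        [/\ ((1 / 16)%:E <= limn_einf u)%E,
            (limn_einf u <= limn_esup u)%E &
            (limn_esup u <= (9 / 4)%:E)%E]} &
      1 / 2 < theta ->
      {ae P, forall w,
        let u n := (ln (M n w) / ln (N n w))%:E in
        [/\ ((theta / beta)%:E <= limn_einf u)%E,
            (limn_einf u <= limn_esup u)%E &
            (limn_esup u <= beta^-1%:E)%E]}].
Proof.
move=> N M gamma beta; split=> ht.
- apply: filterS2 (subcritical_lower theta_gt0 ht dd)
    (subcritical_upper theta_gt0 ht dd) => w lo up.
  apply: And3; first exact: le_limn_einf lo.
    exact: limn_einf_sup.
  exact: limn_esup_le up.
- apply: filterS2 (critical_lower ht dd) (critical_upper ht dd) => w lo up.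
  apply: And3; first exact: le_limn_einf lo.
    exact: limn_einf_sup.
  exact: limn_esup_le up.
(* Outside one null set the bound holds for all [k], and [3 / (k + 1)] gets arbitrarily small. *)
- have up := ae_foralln (fun k => supercritical_upper ht theta_lt1 dd k).
  apply: filterS2 (supercritical_lower ht theta_lt1 dd) up => w lo {}up.
  apply: And3; [exact: le_limn_einf lo|exact: limn_einf_sup|].
  apply/lee_addgt0Pr => e e0; pose k := Num.truncn (3 / e).
  apply: (le_trans (limn_esup_le (up k))).
  rewrite -EFinD lee_fin lerD2l ler_pdivrMr// mulrC -ler_pdivrMr//.
  exact: ltW (truncnS_gt _).
Qed.
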